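(* For each integer $n\geq 0$ and each unital semilattice $H$ there exist bounded linear maps $\sigma^H_n:\mathcal{C}_n(\mathcal{A}_H)\to\mathcal{C}_{n+1}(\mathcal{A}_H)$ which are natural in $H$ (that is, for every homomorphism of unital semilattices $\theta:H\to K$ and every $n\geq 0$ one has $\theta^{\otimes n+2}\circ\sigma^H_n=\sigma^K_n\circ\theta^{\otimes n+1}$) and which satisfy $$\mathsf{d}^H_n\sigma^H_n+\sigma^H_{n-1}\mathsf{d}^H_{n-1}=\mathrm{id}\qquad\text{for all } n\geq 1$$ and all unital semilattices $H$. In particular, the simplicial Hochschild chain complex $\mathcal{C}_*(\mathcal{A}_H)$ is split exact in degrees $1$ and above.
   Context: A semilattice is a commutative semigroup in which every element is idempotent; it is unital if it has an identity element. Homomorphisms of unital semilattices are monoid homomorphisms (identity-preserving). For a semigroup $H$, $\mathcal{A}_H=\ell^1(H)$ is the Banach algebra with convolution product, determined by $e_se_t=e_{st}$ on basis vectors. A homomorphism $\theta:H\to K$ induces a contractive algebra homomorphism $\mathcal{A}_H\to\mathcal{A}_K$, $e_s\mapsto e_{\theta(s)}$, also denoted $\theta$. For a Banach algebra $A$ and $n\geq 0$, $\mathcal{C}_n(A)=A\widehat{\otimes}A^{\widehat{\otimes}n}$ ($n+1$ factors, projective tensor product of Banach spaces), and the Hochschild boundary operator $\mathsf{d}_n:\mathcal{C}_{n+1}(A)\to\mathcal{C}_n(A)$ is the bounded linear map $$\mathsf{d}_n(a_0\otimes a_1\otimes\cdots\otimes a_{n+1})=a_0a_1\otimes a_2\otimes\cdots\otimes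 a_{n+1}+\sum_{j=1}^n(-1)^ja_0\otimes\cdots\otimes a_ja_{j+1}\otimes\cdots\otimes a_{n+1}+(-1)^{n+1}a_{n+1}a_0\otimes a_1\otimes\cdots\otimes a_n.$$ For $A=\mathcal{A}_H$ it is written $\mathsf{d}^H_n$. For an algebra homomorphism $f:A\to B$, $f^{\otimes n+1}:\mathcal{C}_n(A)\to\mathcal{C}_n(B)$ is the induced map on projective tensor powers. *)

(* Defs.v *)
From HB Require Import structures.
From mathcomp Require Import all_boot all_order all_algebra finmap.
From mathcomp Require Import generic_quotient lra complex.
From mathcomp Require Import boolp classical_sets functions cardinality fsbigop.
From mathcomp Require Import reals ereal topology normedtype sequences esum.
From mathcomp Require Import summability.

Set Implicit Arguments.
Unset Strict Implicit.
Unset Printing Implicit Defensive.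

Import Order.TTheory GRing.Theory Num.Theory.
Import numFieldNormedType.Exports.

Local Open Scope classical_set_scope.
Local Open Scope complex_scope.
Local Open Scope ring_scope.

Section rnorm.
Variable R : realType.
Local Notation C := R[i].

(* Norms of normed modules over R[i] take values in R[i]; rnorm is the same
   norm as an element of R. *)
Definition rnorm (V : normedZmodType C) (v : V) : R := complex.Re `|v|.

Lemma rnormE (V : normedZmodType C) (v : V) : `|v| = (rnorm v)%:C.
Proof. by rewrite /rnorm RRe_real// normr_real. Qed.

Lemma rnorm_ge0 (V : normedZmodType C) (v : V) : 0 <= rnorm v.
Proof. by rewrite -ler0c -rnormE. Qed.

Lemma ler_rnormD (V : normedZmodType C) (v w : V) :
  rnorm (v + w) <= rnorm v + rnorm w.
Proof. by rewrite -lecR rmorphD /= -!rnormE ler_normD. Qed.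

Lemma rnorm0 (V : normedZmodType C) : rnorm (0 : V) = 0.
Proof. by rewrite /rnorm normr0. Qed.

Lemma rnormN (V : normedZmodType C) (v : V) : rnorm (- v) = rnorm v.
Proof. by rewrite /rnorm normrN. Qed.

Lemma rdistC (V : normedZmodType C) (v w : V) : rnorm (v - w) = rnorm (w - v).
Proof. by rewrite -rnormN opprB. Qed.

Lemma rnorm_eq0 (V : normedZmodType C) (v : V) : rnorm v = 0 -> v = 0.
Proof. by move=> v0; apply: normr0_eq0; rewrite rnormE v0. Qed.

Lemma rnormZ (V : normedModType C) (c : C) (v : V) :
  rnorm (c *: v) = rnorm c * rnorm v.
Proof. by apply: complexI; rewrite rmorphM /= -!rnormE normrZ. Qed.

Lemma rnormM (c d : C) : rnorm (c * d) = rnorm c * rnorm d.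
Proof. by apply: complexI; rewrite rmorphM /= -!rnormE normrM. Qed.

Lemma rnormr (x : R) : 0 <= x -> rnorm (x%:C : C) = x.
Proof. by move=> x0; apply: complexI; rewrite -rnormE ger0_norm// ler0c. Qed.

Lemma rnorm1 : rnorm (1 : C) = 1.
Proof. by rewrite /rnorm normr1. Qed.

Lemma ler_rnorm_sum (V : normedZmodType C) (I : Type) (s : seq I) (F : I -> V) :
  rnorm (\sum_(i <- s) F i) <= \sum_(i <- s) rnorm (F i).
Proof.
elim: s => [|i s ih]; first by rewrite !big_nil rnorm0.
by rewrite !big_cons (le_trans (ler_rnormD _ _))// lerD2l.
Qed.

Lemma ler_rnorm_le (V : normedZmodType C) (v w u : V) :
  rnorm (v - w) <= rnorm (v - u) + rnorm (u - w).
Proof. by rewrite (le_trans _ (ler_rnormD _ _))// addrA subrK. Qed.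

Lemma norm_leP (V W : normedZmodType C) (v : V) (w : W) (M : R) :
  (`|v| <= M%:C * `|w|) = (rnorm v <= M * rnorm w).
Proof. by rewrite !rnormE -rmorphM lecR. Qed.

Lemma posC (e : C) : 0 < e -> exists2 r : R, 0 < r & e = r%:C.
Proof.
move=> e0; exists (complex.Re e); first by move: e0; rewrite ltcE => /andP[].
by rewrite RRe_real// gtr0_real.
Qed.

Lemma rcvgP (V : normedModType C) (F : set_system V) (FF : Filter F) (l : V) :
  F --> l <-> forall e : R, 0 < e -> \forall v \near F, rnorm (l - v) <= e.
Proof.
split=> [/cvgrPdist_le Fl e e0|H].
  have /Fl : 0 < e%:C by rewrite ltcR.
  by apply: filterS => v; rewrite rnormE lecR.
apply/cvgrPdist_le => _ /posC[e e0 ->]; move: (H _ e0).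
by apply: filterS => v; rewrite rnormE lecR.
Qed.

Lemma rcauchy_exP (V : normedModType C) (F : set_system V) (FF : Filter F) :
  (forall e : R, 0 < e -> exists v, \forall w \near F, rnorm (v - w) < e) ->
  cauchy F.
Proof.
move=> H; apply: cauchy_exP => _ /posC[e e0 ->].
have [v Fv] := H _ e0; exists v; move: Fv.
apply: filterS => w; rewrite -ball_normE /= => h.
by rewrite rnormE ltcR.
Qed.

Lemma rcauchyP (V : normedModType C) (F : set_system V) (FF : ProperFilter F) :
  cauchy F ->
  forall e : R, 0 < e -> exists v, \forall w \near F, rnorm (v - w) < e.
Proof.
move=> /cauchyP cF e e0.
have [|v Fv] := cF e%:C; first by rewrite ltcR.
exists v; move: Fv; apply: filterS => w.
by rewrite -ball_normE /= rnormE ltcR.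
Qed.

Lemma ge0_le_eps (x y : R) : (forall e, 0 < e -> x <= y + e) -> x <= y.
Proof. by move=> h; apply/ler_addgt0Pr. Qed.

End rnorm.

Section ell1_def.
Variables (R : realType) (X : choiceType).
Local Notation C := R[i].

Definition ell1_pred : {pred X -> C} :=
  fun f => esum.summable [set: X] (fun x => (rnorm (f x))%:E).

Record ell1 := Ell1 { ell1_fun :> X -> C; _ : ell1_fun \in ell1_pred }.

HB.instance Definition _ := [isSub for ell1_fun].
HB.instance Definition _ := [Choice of ell1 by <:].

Lemma ell1_predP (f : X -> C) : reflect
  (exists M : R, forall A : {fset X}, \sum_(x <- A) rnorm (f x) <= M)
  (f \in ell1_pred).
Proof.
have absE x : (`|(rnorm (f x))%:E| = (rnorm (f x))%:E)%E.
  by rewrite gee0_abs// lee_fin rnorm_ge0.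
rewrite /in_mem /= /ell1_pred /esum.summable.
under eq_esum do rewrite absE.
apply: (iffP idP) => [|[M fM]].
  have /ge0_fin_numE <- : (0 <= \esum_(i in [set: X]) (rnorm (f i))%:E)%E.
    by apply: esum_ge0 => x _; rewrite lee_fin rnorm_ge0.
  move=> /fineK sE; exists (fine (\esum_(i in [set: X]) (rnorm (f i))%:E)) => A.
  rewrite -lee_fin sE; apply: esum_ge; exists [set` A].
    by split=> //; exact: finite_fset.
  rewrite fsbig_finite/=; last exact: finite_fset.
  by rewrite set_fsetK sumEFin.
apply: (@le_lt_trans _ _ M%:E); last exact: ltry.
apply: ge_ereal_sup => _ [A [finA _] <-].
by rewrite fsbig_finite//= sumEFin lee_fin.
Qed.

Lemma ell1_submod_closed : submod_closed ell1_pred.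
Proof.
split.
  apply/ell1_predP; exists 0 => A; rewrite big1// => x _.
  by rewrite [X in rnorm X](_ : _ = 0)// rnorm0.
move=> c f g /ell1_predP[M fM] /ell1_predP[N gN].
apply/ell1_predP; exists (rnorm c * M + N) => A.
rewrite (@le_trans _ _ (\sum_(x <- A) (rnorm c * rnorm (f x) + rnorm (g x))))//.
  by apply: ler_sum => x _; rewrite -rnormM; exact: ler_rnormD.
by rewrite big_split/= -mulr_sumr lerD// ler_wpM2l// rnorm_ge0.
Qed.

HB.instance Definition _ := GRing.isSubmodClosed.Build C (X -> C) ell1_pred
  ell1_submod_closed.
HB.instance Definition _ := [SubChoice_isSubLmodule of ell1 by <:].

Definition ell1_rnorm (f : ell1) : R :=
  fine (\esum_(x in [set: X]) (rnorm (f x))%:E).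

Lemma ell1_esumE (f : ell1) :
  (\esum_(x in [set: X]) (rnorm (f x))%:E = (ell1_rnorm f)%:E)%E.
Proof.
rewrite /ell1_rnorm fineK// ge0_fin_numE.
  have := valP f; rewrite /in_mem /= /ell1_pred /esum.summable.
  by under eq_esum do rewrite gee0_abs ?lee_fin ?rnorm_ge0//.
by apply: esum_ge0 => x _; rewrite lee_fin rnorm_ge0.
Qed.

Lemma ell1_rnorm_ge (f : ell1) (A : {fset X}) :
  \sum_(x <- A) rnorm (f x) <= ell1_rnorm f.
Proof.
rewrite -lee_fin -ell1_esumE; apply: esum_ge; exists [set` A].
  by split=> //; exact: finite_fset.
rewrite fsbig_finite/=; last exact: finite_fset.
by rewrite set_fsetK sumEFin.
Qed.

Lemma ell1_rnorm_le (f : ell1) (M : R) :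
  (forall A : {fset X}, \sum_(x <- A) rnorm (f x) <= M) -> ell1_rnorm f <= M.
Proof.
move=> fM; rewrite -lee_fin -ell1_esumE.
apply: ge_ereal_sup => _ [A [finA _] <-].
by rewrite fsbig_finite//= sumEFin lee_fin.
Qed.

Lemma ell1_rnorm_ge0 (f : ell1) : 0 <= ell1_rnorm f.
Proof. by have := ell1_rnorm_ge f fset0; rewrite big_seq_fset0. Qed.

Lemma ell1_rnorm_coord (f : ell1) x : rnorm (f x) <= ell1_rnorm f.
Proof. by have := ell1_rnorm_ge f [fset x]%fset; rewrite big_seq_fset1. Qed.

Definition ell1_norm (f : ell1) : C := (ell1_rnorm f)%:C.

Fact ell1_normD f g : ell1_norm (f + g) <= ell1_norm f + ell1_norm g.
Proof.
rewrite /ell1_norm -rmorphD lecR; apply: ell1_rnorm_le => A.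
rewrite (@le_trans _ _ (\sum_(x <- A) (rnorm (f x) + rnorm (g x))))//.
  by apply: ler_sum => x _; exact: ler_rnormD.
by rewrite big_split/= lerD// ell1_rnorm_ge.
Qed.

Fact ell1_rnormZ_le c f : ell1_rnorm (c *: f) <= rnorm c * ell1_rnorm f.
Proof.
apply: ell1_rnorm_le => A.
rewrite (eq_bigr (fun x => rnorm c * rnorm (f x))); last first.
  by move=> x _; rewrite -rnormM.
by rewrite -mulr_sumr ler_wpM2l ?rnorm_ge0// ell1_rnorm_ge.
Qed.

Fact ell1_normZ c f : ell1_norm (c *: f) = `|c| * ell1_norm f.
Proof.
rewrite rnormE /ell1_norm -rmorphM; congr (_%:C).
apply/eqP; rewrite eq_le ell1_rnormZ_le /=.
have [->|c0] := eqVneq c 0; first by rewrite rnorm0 mul0r ell1_rnorm_ge0.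
have := ell1_rnormZ_le c^-1 (c *: f); rewrite scalerA mulVf// scale1r.
move=> /(ler_wpM2l (rnorm_ge0 c)) /le_trans; apply.
by rewrite mulrA -rnormM mulfV// rnorm1 mul1r.
Qed.

Fact ell1_norm_eq0 f : ell1_norm f = 0 -> f = 0.
Proof.
move=> /complexI f0; apply: val_inj; apply/funext => x /=.
apply: (@rnorm_eq0 R C); apply/eqP.
by rewrite eq_le rnorm_ge0 andbT -[leRHS]f0 ell1_rnorm_coord.
Qed.

HB.instance Definition _ :=
  Lmodule_isNormed.Build C ell1 ell1_normD ell1_normZ ell1_norm_eq0.

Lemma ell1_normE (f : ell1) : rnorm f = ell1_rnorm f.
Proof. by apply: complexI; rewrite -rnormE. Qed.

End ell1_def.

Section complex_complete.
Variable R : realType.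
Local Notation C := R[i].

Lemma rnorm_Re (z : C) : `|complex.Re z| <= rnorm z.
Proof. by rewrite -lecR -rnormE; exact: normc_ge_Re. Qed.

Lemma rnorm_i : rnorm ('i : C) = 1.
Proof. by rewrite /rnorm normc_def /= expr0n expr1n add0r sqrtr1. Qed.

Lemma rnorm_Im (z : C) : `|complex.Im z| <= rnorm z.
Proof.
by rewrite -normrN -ReiNIm (le_trans (rnorm_Re _))// rnormM rnorm_i mulr1.
Qed.

Lemma rnormRI (z : C) : rnorm z <= `|complex.Re z| + `|complex.Im z|.
Proof.
have rr (x : R) : rnorm (x%:C : C) = `|x|.
  by rewrite /rnorm normc_def /= expr0n addr0 sqrtr_sqr.
rewrite {1}[z]complexE (le_trans (ler_rnormD _ _))// rnormM rnorm_i mul1r.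
by rewrite !rr.
Qed.

Lemma R_cauchy_lim (T : Type) (G : set_system T) (PG : ProperFilter G)
    (u : T -> R) :
  (forall e : R, 0 < e -> exists v, \forall t \near G, `|v - u t| < e) ->
  exists l, forall e : R, 0 < e -> \forall t \near G, `|l - u t| <= e.
Proof.
move=> H; have /cvg_ex[l ul] : cvg (u @ G).
  apply: R_complete; apply: cauchy_exP => e /H[v uv]; exists v.
  by move: uv; apply: filterS => t ?; rewrite -ball_normE.
by exists l => e e0; move/cvgrPdist_le : ul => /(_ _ e0).
Qed.

Lemma C_cauchy_lim (T : Type) (G : set_system T) (PG : ProperFilter G)
    (u : T -> C) :
  (forall e : R, 0 < e -> exists v, \forall t \near G, rnorm (v - u t) < e) ->
  exists l, forall e : R, 0 < e -> \forall t \near G, rnorm (l - u t) <= e.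
Proof.
move=> H.
have [|a ua] := @R_cauchy_lim _ _ PG (fun t => complex.Re (u t)).
  move=> e /H[v uv]; exists (complex.Re v); move: uv; apply: filterS => t.
  by apply: le_lt_trans; rewrite -raddfB; exact: rnorm_Re.
have [|b ub] := @R_cauchy_lim _ _ PG (fun t => complex.Im (u t)).
  move=> e /H[v uv]; exists (complex.Im v); move: uv; apply: filterS => t.
  by apply: le_lt_trans; rewrite -raddfB; exact: rnorm_Im.
exists (Complex a b) => e e0.
have e20 : 0 < e / 2 by rewrite divr_gt0.
near=> t.
apply: (le_trans (rnormRI _)); rewrite [leRHS]splitr lerD//.
  by rewrite raddfB /=; near: t; exact: ua.
by rewrite raddfB /=; near: t; exact: ub.
Unshelve. all: by end_near. Qed.

End complex_complete.

Section ell1_complete.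
Variables (R : realType) (X : choiceType).
Local Notation C := R[i].
Local Notation ell1 := (ell1 R X).

Lemma ell1_complete (F : set_system ell1) :
  ProperFilter F -> cauchy F -> cvg F.
Proof.
move=> FF cF.
have {}cF (e : R) : 0 < e ->
    exists f : ell1, \forall g \near F, ell1_rnorm (f - g) < e.
  move=> e0; have [f ff] := rcauchyP FF cF e0; exists f; move: ff.
  by apply: filterS => g; rewrite ell1_normE.
have lim_ex (x : X) : exists l : C, forall e : R, 0 < e ->
    \forall f \near F, rnorm (l - (f : ell1) x) <= e.
  apply: (@C_cauchy_lim _ _ _ FF (fun f : ell1 => f x)) => e /cF[f Ff].
  exists (f x); move: Ff; apply: filterS => g; apply: le_lt_trans.
  exact: (ell1_rnorm_coord (f - g)).
pose l x := projT1 (cid (lim_ex x)).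
have lP (x : X) (e : R) : 0 < e -> \forall f \near F, rnorm (l x - (f : ell1) x) <= e.
  by rewrite /l; case: cid => /= ?; exact.
have ball_le (f : ell1) (e : R) : (\forall g \near F, ell1_rnorm (f - g) < e) ->
    forall A : {fset X}, \sum_(x <- A) rnorm (f x - l x) <= e.
  move=> Ff A; apply: ge0_le_eps => d d0.
  pose k : R := (size A).+1%:R; have k0 : 0 < k by rewrite ltr0n.
  have dk0 : 0 < d / k by rewrite divr_gt0.
  have Hn : \forall g \near F, forall x, x \in (A : seq X) ->
      rnorm (l x - (g : ell1) x) <= d / k.
    elim: (A : seq X) => [|a s ih]; first by near=> g => x; rewrite in_nil.
    near=> g => x; rewrite inE => /orP[/eqP ->|xs].
      by near: g; exact: lP.
    by move: x xs; near: g.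
  have [g [gf gl]] := filter_ex (filterI Ff Hn).
  rewrite (@le_trans _ _ (\sum_(x <- A) (rnorm ((f - g) x) + d / k)))//.
    rewrite big_seq [leRHS]big_seq; apply: ler_sum => x xA.
    rewrite (le_trans (ler_rnorm_le _ _ (g x)))// lerD//.
    by rewrite rdistC gl.
  rewrite big_split /= lerD//.
    by apply: le_trans (ltW gf); exact: (ell1_rnorm_ge (f - g) A).
  rewrite big_const_seq count_predT iter_addr_0 -mulr_natr -mulrA.
  rewrite ler_piMr ?ltW// mulrC ltr_pdivrMr// mul1r ltr_nat//.
have lin : l \in @ell1_pred R X.
  have [f Ff] := cF 1 ltr01.
  apply/ell1_predP; exists (ell1_rnorm f + 1) => A.
  rewrite (@le_trans _ _ (\sum_(x <- A) (rnorm (f x) + rnorm (f x - l x))))//.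
    apply: ler_sum => x _; rewrite (rdistC (f x)).
    by rewrite addrC (le_trans _ (ler_rnormD _ _))// subrK.
  by rewrite big_split/= lerD// ?ell1_rnorm_ge// ball_le.
apply/cvg_ex; exists (Ell1 lin); apply/rcvgP => e e0.
have e20 : 0 < e / 2 by rewrite divr_gt0.
have [f Ff] := cF _ e20; move: (Ff); apply: filterS => g fg.
rewrite (le_trans (ler_rnorm_le _ _ f))// [leRHS]splitr lerD//.
  by rewrite rdistC ell1_normE; apply: ell1_rnorm_le => A; exact: ball_le.
by rewrite ell1_normE ltW.
Unshelve. all: by end_near. Qed.

HB.instance Definition _ := Uniform_isComplete.Build ell1 ell1_complete.

End ell1_complete.

Lemma big_fset_split (V : nmodType) (X : choiceType) (A B : {fset X})
    (F : X -> V) : (A `<=` B)%fset ->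
  \sum_(x <- B) F x = \sum_(x <- A) F x + \sum_(x <- (B `\` A)%fset) F x.
Proof.
move=> /fsubsetP AB; rewrite (big_fsetID _ (mem A)) /=; congr (_ + _).
  apply: eq_fbigl => x; rewrite !inE /=.
  by case: (boolP (x \in A)) => [/AB ->//|]; rewrite andbF.
by apply: eq_fbigl => x; rewrite !inE /= andbC.
Qed.

#[local] Existing Instance totally_filter.

Section asummable.
Variables (R : realType) (X : choiceType) (E : normedModType R[i]).
Local Notation C := R[i].
Implicit Types (u v : X -> E).

Definition asummable u :=
  exists M : R, forall A : {fset X}, \sum_(x <- A) rnorm (u x) <= M.

Lemma psumE u (A : {fset X}) : partial_sum u A = \sum_(x <- A) u x.
Proof. by rewrite /partial_sum big_seq_fsetE. Qed.

Lemma asummable_tail u : asummable u -> forall e : R, 0 < e ->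
  exists A0 : {fset X}, forall B : {fset X},
    [disjoint A0 & B]%fset -> \sum_(x <- B) rnorm (u x) <= e.
Proof.
move=> [M uM] e e0.
pose S := [set \sum_(x <- A) rnorm (u x) | A in [set: {fset X}]].
have supS : has_sup S.
  split; first by exists (\sum_(x <- fset0) rnorm (u x)); exists fset0.
  by exists M => _ [A _ <-].
have [_ [A0 _ <-] sA0] := sup_adherent e0 supS.
exists A0 => B A0B.
have : \sum_(x <- (A0 `|` B)%fset) rnorm (u x) <= sup S.
  by apply: sup_upper_bound => //; exists (A0 `|` B)%fset.
rewrite (big_fset_split _ (fsubsetUl A0 B)) fsetDUl fsetDv fset0U.
have /fsetDidPl -> : [disjoint B & A0]%fset by rewrite fdisjoint_sym.
move=> h; rewrite -(lerD2l (\sum_(i <- A0) rnorm (u i))).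
by rewrite (le_trans h)// -lerBlDr ltW.
Qed.

End asummable.

Section usum.
Variables (R : realType) (X : choiceType) (E : completeNormedModType R[i]).
Local Notation C := R[i].
Implicit Types (u v : X -> E).

Lemma asummable_cvg u : asummable u ->
  partial_sum u @ totally --> summability.sum u.
Proof.
move=> su; suff : cvg (partial_sum u @ totally) by [].
apply: cauchy_cvg; apply: rcauchy_exP => e e0.
have e20 : 0 < e / 2 by rewrite divr_gt0.
have [A0 A0P] := asummable_tail su e20.
exists (partial_sum u A0); exists A0 => // A /= A0A.
rewrite !psumE rdistC.
have -> : \sum_(x <- A) u x - \sum_(x <- A0) u x =
    \sum_(x <- (A `\` A0)%fset) u x.
  by rewrite (big_fset_split _ A0A) addrC addKr.
rewrite (le_lt_trans (ler_rnorm_sum _ _))// (@le_lt_trans _ _ (e / 2))//.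
  by apply: A0P; rewrite fdisjoint_sym; apply/fdisjointP => x; rewrite !inE => /andP[].
by rewrite gtr_pMr// invf_lt1 ?ltr1n.
Qed.

Lemma usum_approx u : asummable u -> forall e : R, 0 < e ->
  exists A0 : {fset X}, forall A : {fset X}, (A0 `<=` A)%fset ->
    rnorm (summability.sum u - \sum_(x <- A) u x) <= e.
Proof.
move=> /asummable_cvg /rcvgP H e /H [A0 _ A0P]; exists A0 => A /A0P /=.
by rewrite psumE.
Qed.

Lemma usum_unique u l : (forall e : R, 0 < e ->
  exists A0 : {fset X}, forall A : {fset X}, (A0 `<=` A)%fset ->
    rnorm (l - \sum_(x <- A) u x) <= e) -> summability.sum u = l.
Proof.
move=> H; apply: norm_cvg_lim; apply/rcvgP => e /H [A0 A0P].
by exists A0 => // A /A0P h /=; rewrite psumE.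
Qed.

Lemma usum_le u (M : R) :
  (forall A : {fset X}, \sum_(x <- A) rnorm (u x) <= M) ->
  rnorm (summability.sum u) <= M.
Proof.
move=> uM; apply: ge0_le_eps => e e0.
have [|A /(_ A (fsubset_refl _))] := @usum_approx u _ e e0; first by exists M.
move=> h; rewrite -[summability.sum u](subrK (\sum_(x <- A) u x)).
rewrite (le_trans (ler_rnormD _ _))// addrC lerD//.
by rewrite (le_trans (ler_rnorm_sum _ _)).
Qed.

Lemma usum_linear (c : C) u v : asummable u -> asummable v ->
  summability.sum (fun x => c *: u x + v x) =
  c *: summability.sum u + summability.sum v.
Proof.
move=> su sv; apply: usum_unique => e e0.
have k0 : 0 < rnorm c + 1 by rewrite ltr_wpDl ?rnorm_ge0.
have e20 : 0 < e / 2 by rewrite divr_gt0.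
have [A1 A1P] := usum_approx su (divr_gt0 e20 k0).
have [A2 A2P] := usum_approx sv e20.
exists (A1 `|` A2)%fset => A; rewrite fsubUset => /andP[/A1P h1 /A2P h2].
rewrite big_split/= -scaler_sumr opprD addrACA -scalerBr.
rewrite (le_trans (ler_rnormD _ _))// [leRHS]splitr lerD// rnormZ.
rewrite (le_trans (ler_wpM2l (rnorm_ge0 _) h1))//.
by rewrite mulrA ler_pdivrMr// mulrC ler_wpM2l// ?ltW// ltrDl.
Qed.

End usum.

Section bounded_linear.
Variable K : numFieldType.

Definition bounded_linear (V W : normedModType K) (f : V -> W) : Prop :=
  linear f /\ exists M : K, forall x, `|f x| <= M * `|x|.

End bounded_linear.

Section bounded_linear_theory.
Variable R : realType.
Local Notation C := R[i].
Variables (V W : normedModType C).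

Lemma linearf0 (f : V -> W) : linear f -> f 0 = 0.
Proof. by move=> lf; have := lf (-1) 0 0; rewrite !scaler0 addr0 scaleN1r addNr. Qed.

Lemma linearDf (f : V -> W) : linear f -> forall x y, f (x + y) = f x + f y.
Proof. by move=> lf x y; rewrite -[x]scale1r lf !scale1r. Qed.

Lemma linearZf (f : V -> W) : linear f -> forall c x, f (c *: x) = c *: f x.
Proof. by move=> lf c x; rewrite -[c *: x]addr0 lf (linearf0 lf) addr0. Qed.

Lemma linearBf (f : V -> W) : linear f -> forall x y, f (x - y) = f x - f y.
Proof. by move=> lf x y; rewrite linearDf// -scaleN1r linearZf// scaleN1r. Qed.

Lemma linear_sumf (f : V -> W) : linear f -> forall (I : Type) (s : seq I) (F : I -> V),
  f (\sum_(i <- s) F i) = \sum_(i <- s) f (F i).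
Proof.
move=> lf I s F; elim: s => [|i s ih]; first by rewrite !big_nil linearf0.
by rewrite !big_cons linearDf// ih.
Qed.

Lemma bounded_linear_rnorm (f : V -> W) : bounded_linear f <->
  linear f /\ exists2 M : R, 0 <= M & forall x, rnorm (f x) <= M * rnorm x.
Proof.
split=> -[lf [M]].
  move=> fM; split=> //; exists (rnorm M) => [|x]; first exact: rnorm_ge0.
  rewrite -norm_leP (le_trans (fM x))// -rnormE.
  have := le_trans (normr_ge0 _) (fM x) => h.
  by rewrite -[leLHS]ger0_norm// normrM normr_id.
move=> M0 fM; split=> //; exists M%:C => x; by rewrite norm_leP.
Qed.

End bounded_linear_theory.

Lemma bounded_linear_comp (R : realType) (U V W : normedModType R[i])
    (f : V -> W) (g : U -> V) :
  bounded_linear f -> bounded_linear g -> bounded_linear (f \o g).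
Proof.
move=> /bounded_linear_rnorm[lf [M M0 fM]] /bounded_linear_rnorm[lg [N N0 gN]].
apply/bounded_linear_rnorm; split; first by move=> c x y; rewrite /= lg lf.
exists (M * N) => [|x]; first exact: mulr_ge0.
by rewrite (le_trans (fM _))// -mulrA ler_wpM2l.
Qed.

Section ell1_free.
Variables (R : realType) (X : choiceType).
Local Notation C := R[i].
Local Notation ell1 := (ell1 R X).

Fact ell1_basis_subproof (x : X) :
  (fun y => (y == x)%:R : C) \in @ell1_pred R X.
Proof.
apply/ell1_predP; exists 1 => A.
rewrite (big_fsetID _ (pred1 x)) /= [X in _ + X]big1_fset ?addr0; last first.
  by move=> y; rewrite !inE /= => /andP[_ /negPf ->] _; rewrite rnorm0.
case: (boolP (x \in A)) => xA.
  rewrite (@eq_fbigl _ _ _ _ _ [fset x]%fset).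
    by rewrite big_seq_fset1 eqxx rnorm1.
  by move=> y; rewrite !inE /= andbC; case: eqP => // ->.
rewrite big1_fset// => y; rewrite !inE/= => /andP[yA /eqP yx].
by rewrite -yx yA in xA.
Qed.

Definition ell1_basis (x : X) : ell1 := Ell1 (ell1_basis_subproof x).

Lemma rnorm_basis x : rnorm (ell1_basis x) <= 1.
Proof.
rewrite ell1_normE; apply: ell1_rnorm_le => A.
rewrite (big_fsetID _ (pred1 x)) /= [X in _ + X]big1_fset ?addr0; last first.
  by move=> y; rewrite !inE /= => /andP[_ /negPf ->] _; rewrite rnorm0.
case: (boolP (x \in A)) => xA.
  rewrite (@eq_fbigl _ _ _ _ _ [fset x]%fset).
    by rewrite big_seq_fset1 eqxx rnorm1.
  by move=> y; rewrite !inE /= andbC; case: eqP => // ->.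
rewrite big1_fset// => y; rewrite !inE/= => /andP[yA /eqP yx].
by rewrite -yx yA in xA.
Qed.

Lemma ell1_asummable (f : ell1) : asummable (fun x => f x : C^o).
Proof. by exists (ell1_rnorm f) => A; exact: ell1_rnorm_ge. Qed.

Lemma ell1_sum_coord (I : Type) (s : seq I) (F : I -> ell1) y :
  (\sum_(i <- s) F i : ell1) y = \sum_(i <- s) (F i) y.
Proof.
elim: s => [|i s ih]; first by rewrite !big_nil.
by rewrite !big_cons -ih.
Qed.

Lemma ell1_psum_coord (f : ell1) (A : {fset X}) y :
  (\sum_(x <- A) f x *: ell1_basis x) y = if y \in A then f y else 0.
Proof.
rewrite ell1_sum_coord; case: ifPn => yA.
  rewrite (big_fsetD1 y)//= big1_fset ?addr0.
    by rewrite [LHS](_ : _ = f y * (y == y)%:R)// eqxx mulr1.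
  move=> x; rewrite !inE => /andP[xy _] _.
  rewrite [LHS](_ : _ = f x * (y == x)%:R)//.
  by rewrite eq_sym (negPf xy) mulr0.
rewrite big1_fset// => x xA _.
rewrite [LHS](_ : _ = f x * (y == x)%:R)//.
case: eqP => [yx|_]; last by rewrite mulr0.
by rewrite -yx (negPf yA) in xA.
Qed.

Lemma ell1_approx (f : ell1) (e : R) : 0 < e ->
  exists A0 : {fset X}, forall A : {fset X}, (A0 `<=` A)%fset ->
    rnorm (f - \sum_(x <- A) f x *: ell1_basis x) <= e.
Proof.
move=> e0; have [A0 A0P] := asummable_tail (ell1_asummable f) e0.
exists A0 => A A0A; rewrite ell1_normE; apply: ell1_rnorm_le => B.
rewrite (eq_bigr (fun x => rnorm (f x - if x \in A then f x else 0))).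
  2: by move=> x _; rewrite -ell1_psum_coord.
rewrite (big_fsetID _ (mem A)) /= big1_fset ?add0r; last first.
  by move=> x; rewrite !inE /= => /andP[_ ->] _; rewrite subrr rnorm0.
apply: le_trans (A0P [fset x in B | x \notin A]%fset _); last first.
  apply/fdisjointP => x xA0; rewrite !inE negb_and negbK.
  by rewrite (fsubsetP A0A _ xA0) orbT.
rewrite big_seq [leRHS]big_seq; apply: ler_sum => x.
by rewrite !inE /= => /andP[_ /negPf ->]; rewrite subr0.
Qed.

Lemma ell1_basis_sum (f : ell1) :
  summability.sum (fun x => f x *: ell1_basis x) = f.
Proof. by apply: usum_unique => e e0; exact: ell1_approx. Qed.

Lemma ell1_ext_eq (E : normedModType C) (g h : ell1 -> E) :
  bounded_linear g -> bounded_linear h ->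
  (forall x, g (ell1_basis x) = h (ell1_basis x)) -> g = h.
Proof.
move=> /bounded_linear_rnorm [lg [M M0 gM]].
move=> /bounded_linear_rnorm [lh [N N0 hN]] gh; apply/funext => f.
apply/eqP; rewrite -subr_eq0; apply/eqP/(@rnorm_eq0 R)/eqP.
rewrite eq_le rnorm_ge0 andbT; apply: ge0_le_eps => e e0; rewrite add0r.
have k0 : 0 < M + N + 1 by rewrite ltr_wpDl// addr_ge0.
have [A0 /(_ _ (fsubset_refl _))] := ell1_approx f (divr_gt0 e0 k0).
set p := \sum_(_ <- _) _ => fp.
have gp : g p = h p.
  rewrite /p !linear_sumf//; apply: eq_bigr => x _.
  by rewrite !linearZf// gh.
have -> : g f - h f = g (f - p) - h (f - p).
  by rewrite (linearBf lg) (linearBf lh) gp opprB addrA subrK.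
rewrite (le_trans (ler_rnormD _ _))// rnormN.
rewrite (le_trans (lerD (gM _) (hN _)))// -mulrDl.
rewrite (le_trans (ler_wpM2l _ fp)) ?addr_ge0//.
by rewrite mulrA ler_pdivrMr// mulrC ler_wpM2l// ?ltW// ltrDl.
Qed.

Section ext.
Variable E : completeNormedModType C.

(* The bounded linear extension of a bounded function m on the basis:
   ell1 R X is the free Banach space on X. *)
Definition ell1_ext (m : X -> E) (f : ell1) : E :=
  summability.sum (fun x => f x *: m x).

Lemma ell1_ext_bound (m : X -> E) (M : R) : (forall x, rnorm (m x) <= M) ->
  forall (f : ell1) (A : {fset X}),
    \sum_(x <- A) rnorm (f x *: m x) <= M * rnorm f.
Proof.
move=> mM f A; rewrite (@le_trans _ _ (\sum_(x <- A) M * rnorm (f x)))//.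
  by apply: ler_sum => x _; rewrite rnormZ mulrC ler_wpM2r// rnorm_ge0.
rewrite -mulr_sumr; have [->|/fset0Pn [x _]] := eqVneq A fset0.
  rewrite big_seq_fset0 mulr0; have [x|noX] := pselect (inhabited X).
    by case: x => x; rewrite mulr_ge0 ?rnorm_ge0// (le_trans (rnorm_ge0 _) (mM x)).
  rewrite [f](_ : _ = 0) ?rnorm0 ?mulr0//.
  by apply: val_inj; apply/funext => x; case: noX.
rewrite ler_wpM2l ?(le_trans (rnorm_ge0 _) (mM x))//.
by rewrite ell1_normE ell1_rnorm_ge.
Qed.

Lemma ell1_ext_asummable (m : X -> E) (M : R) : (forall x, rnorm (m x) <= M) ->
  forall f : ell1, asummable (fun x => f x *: m x).
Proof. by move=> mM f; exists (M * rnorm f); exact: ell1_ext_bound. Qed.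

Lemma ell1_ext_le (m : X -> E) (M : R) : (forall x, rnorm (m x) <= M) ->
  forall f, rnorm (ell1_ext m f) <= M * rnorm f.
Proof. by move=> mM f; apply: usum_le; exact: ell1_ext_bound. Qed.

Lemma ell1_ext_linear (m : X -> E) (M : R) : (forall x, rnorm (m x) <= M) ->
  linear (ell1_ext m).
Proof.
move=> mM c f g; rewrite /ell1_ext -usum_linear; [|exact: ell1_ext_asummable mM _..].
congr (summability.sum _); apply/funext => x.
by rewrite scalerA -scalerDl.
Qed.

Lemma ell1_ext_bounded_linear (m : X -> E) (M : R) : (forall x, rnorm (m x) <= M) ->
  bounded_linear (ell1_ext m).
Proof.
move=> mM; apply/bounded_linear_rnorm; split; first exact: ell1_ext_linear mM.
have mN x : rnorm (m x) <= `|M| by rewrite (le_trans (mM x))// ler_norm.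
by exists `|M| => // f; exact: ell1_ext_le.
Qed.

Lemma ell1_ext_basis (m : X -> E) x : ell1_ext m (ell1_basis x) = m x.
Proof.
apply: usum_unique => e e0; exists [fset x]%fset => A; rewrite fsub1set => xA.
rewrite (big_fsetD1 x)//= big1_fset ?addr0 ?eqxx ?scale1r ?subrr ?rnorm0 ?ltW//.
by move=> y; rewrite !inE => /andP[/negPf -> _] _; rewrite scale0r.
Qed.

End ext.
End ell1_free.

Section quotient_banach.
Variables (R : realType) (B : completeNormedModType R[i]).
Local Notation C := R[i].

(* The quotient of a Banach space by a closed subspace, with the quotient
   norm; it is only used to construct projective tensor powers. *)
Record closed_submod := ClosedSubmod {
  submod_mem :> B -> Prop;
  submod_mem0 : submod_mem 0;
  submod_memP : forall (c : C) x y,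
    submod_mem x -> submod_mem y -> submod_mem (c *: x + y);
  submod_closed_mem : forall x,
    (forall e : R, 0 < e -> exists2 y, submod_mem y & rnorm (x - y) <= e) ->
    submod_mem x }.

Variable N : closed_submod.

Lemma submod_memD x y : N x -> N y -> N (x + y).
Proof. by move=> *; rewrite -[x]scale1r; exact: submod_memP. Qed.

Lemma submod_memZ (c : C) x : N x -> N (c *: x).
Proof.
by move=> *; rewrite -[_ *: _]addr0; apply: submod_memP => //; exact: submod_mem0.
Qed.

Lemma submod_memN x : N x -> N (- x).
Proof. by move=> ?; rewrite -scaleN1r; exact: submod_memZ. Qed.

Definition quot_rel : rel B := fun x y => `[< N (x - y) >].

Fact quot_rel_equiv : equiv_class_of quot_rel.
Proof.
split=> [x|x y|y x z]; rewrite /quot_rel.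
- by rewrite subrr; apply/asboolP; exact: submod_mem0.
- by apply/asboolP/asboolP => /submod_memN; rewrite opprB.
- move=> /asboolP xy /asboolP yz; apply/asboolP.
  by rewrite -(subrK y x) -addrA; exact: submod_memD.
Qed.

Canonical quot_rel_equiv_rel := EquivRelPack quot_rel_equiv.

Definition bquot := {eq_quot quot_rel}%qT.
HB.instance Definition _ : EqQuotient B quot_rel bquot := EqQuotient.on bquot.
HB.instance Definition _ := Choice.on bquot.

Definition bpi (x : B) : bquot := \pi_bquot%qT x.

Lemma bpiP x y : bpi x = bpi y <-> N (x - y).
Proof.
split=> [/eqP|h].
  by rewrite /bpi eqmodE => /asboolP.
by apply/eqP; rewrite /bpi eqmodE; apply/asboolP.
Qed.

Lemma bpi_repr (q : bquot) : bpi (repr q) = q.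
Proof. exact: reprK. Qed.

Lemma brepr_pi x : N (repr (bpi x) - x).
Proof. by apply/bpiP; rewrite bpi_repr. Qed.

Definition badd (p q : bquot) := bpi (repr p + repr q).
Definition bopp (p : bquot) := bpi (- repr p).
Definition bscale (c : C) (p : bquot) := bpi (c *: repr p).

Lemma badd_pi x y : badd (bpi x) (bpi y) = bpi (x + y).
Proof.
by apply/bpiP; rewrite opprD addrACA; apply: submod_memD; exact: brepr_pi.
Qed.
Lemma bopp_pi x : bopp (bpi x) = bpi (- x).
Proof. by apply/bpiP; rewrite -opprD; apply: submod_memN; exact: brepr_pi. Qed.
Lemma bscale_pi c x : bscale c (bpi x) = bpi (c *: x).
Proof. by apply/bpiP; rewrite -scalerBr; apply: submod_memZ; exact: brepr_pi. Qed.

Lemma bquotW (P : bquot -> Prop) : (forall x, P (bpi x)) -> forall q, P q.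
Proof. by move=> h q; rewrite -[q]bpi_repr. Qed.

Fact baddA : associative badd.
Proof. by elim/bquotW=> x; elim/bquotW=> y; elim/bquotW=> z; rewrite !badd_pi addrA. Qed.
Fact baddC : commutative badd.
Proof. by elim/bquotW=> x; elim/bquotW=> y; rewrite !badd_pi addrC. Qed.
Fact badd0 : left_id (bpi 0) badd.
Proof. by elim/bquotW=> x; rewrite !badd_pi add0r. Qed.
Fact baddN : left_inverse (bpi 0) bopp badd.
Proof. by elim/bquotW=> x; rewrite bopp_pi badd_pi addNr. Qed.

HB.instance Definition _ := GRing.isZmodule.Build bquot baddA baddC badd0 baddN.

Lemma bpiD x y : bpi (x + y) = bpi x + bpi y.
Proof. by rewrite -badd_pi. Qed.

Fact bscaleA (a b : C) q : bscale a (bscale b q) = bscale (a * b) q.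
Proof. by elim/bquotW: q => x; rewrite !bscale_pi scalerA. Qed.
Fact bscale1 : left_id 1 bscale.
Proof. by elim/bquotW=> x; rewrite !bscale_pi scale1r. Qed.
Fact bscaleDr : right_distributive bscale +%R.
Proof.
by move=> a; elim/bquotW=> x; elim/bquotW=> y; rewrite -bpiD !bscale_pi -bpiD scalerDr.
Qed.
Fact bscaleDl q : {morph bscale^~ q : a b / a + b}.
Proof. by elim/bquotW: q => x a b; rewrite !bscale_pi -bpiD scalerDl. Qed.

HB.instance Definition _ := GRing.Zmodule_isLmodule.Build C bquot
  bscaleA bscale1 bscaleDr bscaleDl.

Lemma bpiZ c x : bpi (c *: x) = c *: bpi x.
Proof. by rewrite -bscale_pi. Qed.
Lemma bpi0 : bpi 0 = 0. Proof. by []. Qed.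
Lemma bpiN x : bpi (- x) = - bpi x.
Proof. by rewrite -scaleN1r bpiZ scaleN1r. Qed.
Lemma bpiB x y : bpi (x - y) = bpi x - bpi y.
Proof. by rewrite bpiD bpiN. Qed.

Definition qset (q : bquot) := [set rnorm x | x in [set x | bpi x = q]].
Definition qnorm (q : bquot) : R := inf (qset q).

Lemma qset_has_inf q : has_inf (qset q).
Proof.
split; first by exists (rnorm (repr q)), (repr q) => //=; exact: bpi_repr.
by exists 0 => _ [x _ <-]; exact: rnorm_ge0.
Qed.

Lemma qnorm_le x : qnorm (bpi x) <= rnorm x.
Proof. by apply: ge_inf; [case: (qset_has_inf (bpi x))|exists x]. Qed.

Lemma qnorm_lift q (e : R) : 0 < e -> exists2 x, bpi x = q & rnorm x < qnorm q + e.
Proof.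
move=> e0; have [_ [x xq <-] h] := inf_adherent e0 (qset_has_inf q).
by exists x.
Qed.

Lemma qnorm_ge0 q : 0 <= qnorm q.
Proof.
apply: lb_le_inf; first by case: (qset_has_inf q).
by move=> _ [x _ <-]; exact: rnorm_ge0.
Qed.

Lemma qnormD p q : qnorm (p + q) <= qnorm p + qnorm q.
Proof.
apply: ge0_le_eps => e e0; have e20 : 0 < e / 2 by rewrite divr_gt0.
have [x <- xp] := qnorm_lift p e20; have [y <- yq] := qnorm_lift q e20.
rewrite -bpiD (le_trans (qnorm_le _))// (le_trans (ler_rnormD _ _))//.
by rewrite [e]splitr addrACA lerD// ltW.
Qed.

Lemma qnormZ_le (c : C) q : qnorm (c *: q) <= rnorm c * qnorm q.
Proof.
apply: ge0_le_eps => e e0.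
have k0 : 0 < rnorm c + 1 by rewrite ltr_wpDl ?rnorm_ge0.
have [x <- xq] := qnorm_lift q (divr_gt0 e0 k0).
rewrite -bpiZ (le_trans (qnorm_le _))// rnormZ.
rewrite (le_trans (ler_wpM2l (rnorm_ge0 _) (ltW xq)))// mulrDr lerD2l.
by rewrite mulrA ler_pdivrMr// mulrC ler_wpM2l// ?ltW// ltrDl.
Qed.

Definition bnorm (q : bquot) : C := (qnorm q)%:C.

Fact bnormD p q : bnorm (p + q) <= bnorm p + bnorm q.
Proof. by rewrite -rmorphD lecR qnormD. Qed.

Fact bnormZ c q : bnorm (c *: q) = `|c| * bnorm q.
Proof.
rewrite rnormE /bnorm -rmorphM; congr (_%:C).
apply/eqP; rewrite eq_le qnormZ_le /=.
have [->|c0] := eqVneq c 0; first by rewrite rnorm0 mul0r qnorm_ge0.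
have := qnormZ_le c^-1 (c *: q); rewrite scalerA mulVf// scale1r.
move=> /(ler_wpM2l (rnorm_ge0 c)) /le_trans; apply.
by rewrite mulrA -rnormM mulfV// rnorm1 mul1r.
Qed.

Fact bnorm_eq0 q : bnorm q = 0 -> q = 0.
Proof.
move=> /complexI; elim/bquotW: q => x x0; rewrite -bpi0; apply/bpiP.
rewrite subr0; apply: (@submod_closed_mem N) => e e0.
have [y /esym/bpiP yx] := qnorm_lift (bpi x) e0; rewrite x0 add0r => ye.
exists (x - y) => //.
by rewrite opprB addrC subrK ltW.
Qed.

HB.instance Definition _ := Lmodule_isNormed.Build C bquot bnormD bnormZ bnorm_eq0.

Lemma bnormE (q : bquot) : rnorm q = qnorm q.
Proof. by apply: complexI; rewrite -rnormE. Qed.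

Lemma pow2_lt (e : R) : 0 < e -> exists n : nat, (2^-1) ^+ n < e.
Proof.
move=> e0; exists (Num.trunc e^-1).+1.
have h : e^-1 < 2 ^+ (Num.trunc e^-1).+1.
  apply: lt_trans (truncnS_gt _) _.
  by rewrite -natrX ltr_nat ltn_expl.
by rewrite exprVn -[ltRHS]invrK ltf_pV2// posrE ?invr_gt0// exprn_gt0.
Qed.

Lemma bquot_complete (F : set_system bquot) : ProperFilter F -> cauchy F -> cvg F.
Proof.
move=> FF cF; pose h k : R := (2^-1) ^+ k.
have h0 k : 0 < h k by rewrite exprn_gt0// invr_gt0.
have hS k : h k = h k.+1 + h k.+1.
  have e2 : 2^-1 + 2^-1 = 1 :> R by rewrite [RHS]splitr mul1r.
  by rewrite /h exprS -mulrDl e2 mul1r.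
have qex k : exists q : bquot, \forall w \near F, rnorm (q - w) < h k.
  exact: rcauchyP.
pose q k := projT1 (cid (qex k)).
have qP k : \forall w \near F, rnorm (q k - w) < h k.
  by rewrite /q; case: cid.
have qq k : rnorm (q k.+1 - q k) < h k + h k.
  have [w [w1 w2]] := filter_ex (filterI (qP k) (qP k.+1)).
  rewrite (le_lt_trans (ler_rnorm_le _ _ w))// ltrD//; last by rewrite rdistC.
  by rewrite (lt_le_trans w2)// [leRHS]hS lerDl ltW.
have dex k : exists2 x, bpi x = q k.+1 - q k & rnorm x < h k + h k + h k.
  have [x xq xl] := qnorm_lift (q k.+1 - q k) (h0 k); exists x => //.
  by rewrite (lt_trans xl)// ltrD2r -bnormE.
pose d k := sval (cid2 (dex k)).
have dP k : bpi (d k) = q k.+1 - q k by rewrite /d; case: cid2.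
have dl k : rnorm (d k) < h k + h k + h k by rewrite /d; case: cid2.
pose f k := repr (q 0%N) + \sum_(i < k) d i.
have fS k : f k.+1 = f k + d k by rewrite /f big_ord_recr/= addrA.
have fP k : bpi (f k) = q k.
  elim: k => [|k ih]; first by rewrite /f big_ord0 addr0 bpi_repr.
  by rewrite fS bpiD ih dP addrC subrK.
have fl n m : rnorm (f (n + m)%N - f n) <= 6 * (h n - h (n + m)%N).
  elim: m => [|m ih]; first by rewrite addn0 !subrr rnorm0 mulr0.
  rewrite addnS (le_trans (ler_rnorm_le _ _ (f (n + m)%N)))//.
  have -> : f (n + m).+1 - f (n + m)%N = d (n + m)%N.
    by rewrite fS [LHS]addrC addKr.
  apply: le_trans (lerD (ltW (dl _)) ih) _.
  rewrite (hS (n + m)%N); set a := h (n + m).+1.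
  by lra.
have fl' n m : (n <= m)%N -> rnorm (f n - f m) <= 6 * h n.
  move=> nm; rewrite rdistC -(subnKC nm) (le_trans (fl _ _))//.
  by rewrite ler_wpM2l// gerBl ltW.
have h_lt (e : R) : 0 < e -> exists n, 6 * h n < e.
  move=> e0; have [|n hn] := @pow2_lt (e / 6); first by rewrite divr_gt0.
  by exists n; rewrite mulrC -ltr_pdivlMr.
have /cvg_ex[l /rcvgP fcl] : cvg (f @ \oo).
  apply: cauchy_cvg; apply: rcauchy_exP => e /h_lt[n hn]; exists (f n).
  by exists n => // m /= nm; rewrite (le_lt_trans (fl' _ _ nm)).
have ln n : rnorm (l - f n) <= 6 * h n.
  apply: ge0_le_eps => e /fcl [m _ ml].
  have := ml (maxn n m) (leq_maxr _ _); rewrite /= => lm.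
  rewrite (le_trans (ler_rnorm_le _ _ (f (maxn n m))))// addrC lerD//.
  by rewrite rdistC fl'// leq_maxl.
apply/cvg_ex; exists (bpi l); apply/rcvgP => e e0.
have e20 : 0 < e / 2 by rewrite divr_gt0.
have [n hn] := h_lt _ e20.
move: (qP n); apply: filterS => w wn.
rewrite (le_trans (ler_rnorm_le _ _ (q n)))// [leRHS]splitr lerD//.
  by rewrite -fP -bpiB bnormE (le_trans (qnorm_le _))// (le_trans (ln _))// ltW.
apply: ltW; apply: (lt_trans wn); apply: le_lt_trans hn.
by rewrite ler_peMl ?ler1n// ltW.
Qed.

HB.instance Definition _ := Uniform_isComplete.Build bquot bquot_complete.

End quotient_banach.

Section multilinear.
Variables (K : numFieldType) (n : nat).

Definition update (T : Type) (a : 'I_n -> T) (i : 'I_n) (x : T) : 'I_n -> T :=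
  fun j => if j == i then x else a j.

Definition multilinear (V W : lmodType K) (m : ('I_n -> V) -> W) : Prop :=
  forall (a : 'I_n -> V) (i : 'I_n) (c : K) (x y : V),
    m (update a i (c *: x + y)) = c *: m (update a i x) + m (update a i y).

Definition mbounded (V W : normedModType K) (M : K) (m : ('I_n -> V) -> W) :
    Prop := forall a, `|m a| <= M * \prod_i `|a i|.

Definition bounded_multilinear (V W : normedModType K)
    (m : ('I_n -> V) -> W) : Prop :=
  multilinear m /\ exists2 M : K, 0 <= M & mbounded M m.

Lemma multilinear_scale (V W : lmodType K) (m : ('I_n -> V) -> W) :
  multilinear m -> forall (a : 'I_n -> V) (c : 'I_n -> K),
  m (fun i => c i *: a i) = (\prod_i c i) *: m a.
Proof.
move=> mm a c.
have updZ b i (d : K) (x : V) : m (update b i (d *: x)) = d *: m (update b i x).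
  have m0 : m (update b i 0) = 0.
    have := mm b i (-1) 0 0; rewrite scaler0 addr0 scaleN1r => {1}->.
    by rewrite addNr.
  by have := mm b i d x 0; rewrite addr0 m0 addr0.
suff H (s : seq 'I_n) : uniq s ->
    m (fun i => if i \in s then c i *: a i else a i) = (\prod_(i <- s) c i) *: m a.
  have := H (index_enum 'I_n) (index_enum_uniq _) => <-.
  by congr m; apply/funext => i; rewrite mem_index_enum.
elim: s => [_|i s ih /= /andP[ns us]]; first by rewrite big_nil scale1r.
rewrite big_cons -scalerA -ih//.
set b := (X in m X = _).
have -> : b = update (fun j => if j \in s then c j *: a j else a j) i (c i *: a i).
  by apply/funext => j; rewrite /b /update inE; case: eqP => [->|].
rewrite updZ; congr (_ *: m _); apply/funext => j; rewrite /update.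
by case: eqP => [->|//]; rewrite (negPf ns).
Qed.

End multilinear.

Section ptensor.
Variables (R : realType) (n : nat).
Local Notation C := R[i].

(* tau exhibits P as the n-fold projective tensor power of V: it is a
   multilinear contraction, and every bounded multilinear map m from V^n to a
   Banach space E factors as m = f \o tau for a unique bounded linear f, with
   the norm of f at most any bound M of m. This determines (P, tau) up to a
   unique isometric isomorphism. *)
Record is_ptensor (V P : completeNormedModType C) (tau : ('I_n -> V) -> P) :
    Prop := IsPtensor {
  ptensor_multilinear : multilinear tau;
  ptensor_le : forall a, `|tau a| <= \prod_i `|a i|;
  ptensor_ext : forall (E : completeNormedModType C) (m : ('I_n -> V) -> E)
      (M : C), 0 <= M -> multilinear m -> mbounded M m ->
    exists2 f : P -> E, linear f /\ (forall x, `|f x| <= M * `|x|) &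
      forall a, f (tau a) = m a;
  ptensor_uniq : forall (E : completeNormedModType C) (f g : P -> E),
    bounded_linear f -> bounded_linear g ->
    (forall a, f (tau a) = g (tau a)) -> f = g
}.

(* Existence: with X = V^n, take the quotient of ell1(X) by the elements killed
   by the extension of a |-> m (a_i / |a_i|)_i for every bounded multilinear m;
   the elementary tensor of a is the class of (\prod_i |a_i|) e_a. *)
Section existence.
Variable V : completeNormedModType C.
Local Notation X := ('I_n -> V).
Local Notation B := (ell1 R ('I_n -> V)).

Let nz (a : X) : X := fun i => (rnorm (a i))^-1%:C *: a i.
Let w (a : X) : C := \prod_i (rnorm (a i))%:C.

Lemma ptensor_nz (a : X) i : a i = (rnorm (a i))%:C *: nz a i.
Proof.
rewrite /nz scalerA -rmorphM /=.
have [/rnorm_eq0 ->|a0] := eqVneq (rnorm (a i)) 0; first by rewrite scaler0.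
by rewrite mulfV// scale1r.
Qed.

Lemma ptensor_nz_le (a : X) i : rnorm (nz a i) <= 1.
Proof.
rewrite /nz rnormZ rnormr ?invr_ge0 ?rnorm_ge0//.
have [->|a0] := eqVneq (rnorm (a i)) 0; first by rewrite mulr0.
by rewrite mulVf.
Qed.

Section fixE.
Variables (E : completeNormedModType C) (m : X -> E) (M : R).
Hypotheses (M0 : 0 <= M) (mm : multilinear m) (mM : mbounded M%:C m).

Lemma ptensor_bd a : rnorm (m (nz a)) <= M.
Proof.
have := mM (nz a); rewrite rnormE -lecR => /le_trans; apply.
rewrite -[leRHS]mulr1 ler_wpM2l ?ler0c//.
apply: prodr_ile1 => i _; rewrite normr_ge0 rnormE /= -[leRHS](rmorph1 (real_complex R)).
by rewrite lecR ptensor_nz_le.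
Qed.

Let T := ell1_ext (fun a => m (nz a)).

Lemma ptensor_T a : T (w a *: ell1_basis R a) = m a.
Proof.
have /bounded_linear_rnorm[lT _] := ell1_ext_bounded_linear ptensor_bd.
rewrite /T (linearZf lT) ell1_ext_basis -multilinear_scale//.
by congr m; apply/funext => i; rewrite -ptensor_nz.
Qed.

End fixE.

Definition ptensor_ker (f : B) : Prop :=
  forall (E : completeNormedModType C) (m : X -> E) (M : R),
    0 <= M -> multilinear m -> mbounded M%:C m ->
    ell1_ext (fun a => m (nz a)) f = 0.

Fact ptensor_ker0 : ptensor_ker 0.
Proof.
move=> E m M M0 mm mM.
have [lT _] := ell1_ext_bounded_linear (ptensor_bd M0 mM).
exact: linearf0.
Qed.

Fact ptensor_kerP (c : C) f g :
  ptensor_ker f -> ptensor_ker g -> ptensor_ker (c *: f + g).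
Proof.
move=> kf kg E m M M0 mm mM.
have [lT _] := ell1_ext_bounded_linear (ptensor_bd M0 mM).
by rewrite lT (kf _ _ _ M0 mm mM) (kg _ _ _ M0 mm mM) scaler0 addr0.
Qed.

Fact ptensor_ker_closed f :
  (forall e : R, 0 < e -> exists2 g, ptensor_ker g & rnorm (f - g) <= e) ->
  ptensor_ker f.
Proof.
move=> H E m M M0 mm mM.
have [lT _] := ell1_ext_bounded_linear (ptensor_bd M0 mM).
apply: (@rnorm_eq0 R); apply/eqP; rewrite eq_le rnorm_ge0 andbT.
apply: ge0_le_eps => e e0; rewrite add0r.
have k0 : 0 < M + 1 by rewrite ltr_wpDl.
have [g kg fg] := H _ (divr_gt0 e0 k0).
rewrite -[X in rnorm X]subr0 -(kg _ _ _ M0 mm mM) -(linearBf lT).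
rewrite (le_trans (ell1_ext_le (ptensor_bd M0 mM) _))//.
rewrite (le_trans (ler_wpM2l M0 fg))//.
by rewrite mulrA ler_pdivrMr// mulrC ler_wpM2l// ?ltW// ltrDl.
Qed.

Let N := ClosedSubmod ptensor_ker0 ptensor_kerP ptensor_ker_closed.
Let tau (a : X) : bquot N := bpi N (w a *: ell1_basis R a).

Lemma ptensor_basis a : bpi N (ell1_basis R a) = tau (nz a).
Proof.
apply/bpiP => E m M M0 mm mM.
have [lT _] := ell1_ext_bounded_linear (ptensor_bd M0 mM).
by rewrite (linearBf lT) (ptensor_T M0 mm mM) ell1_ext_basis subrr.
Qed.

Lemma bpi_bounded_linear : bounded_linear (bpi N).
Proof.
split; first by move=> c x y; rewrite bpiD bpiZ.
by exists 1 => x; rewrite mul1r !rnormE lecR bnormE qnorm_le.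
Qed.

Lemma ptensor_tau : is_ptensor tau.
Proof.
split.
- move=> a i c x y; rewrite /tau -bpiZ -bpiD; apply/bpiP => E m M M0 mm mM.
  have [lT _] := ell1_ext_bounded_linear (ptensor_bd M0 mM).
  rewrite (linearBf lT) lT !(ptensor_T M0 mm mM) mm.
  by rewrite subrr.
- move=> a; rewrite rnormE (eq_bigr (fun i => (rnorm (a i))%:C)); last first.
    by move=> i _; rewrite rnormE.
  rewrite -rmorph_prod lecR bnormE (le_trans (qnorm_le _ _))//.
  rewrite rnormZ /w -rmorph_prod rnormr; last first.
    by apply: prodr_ge0 => i _; exact: rnorm_ge0.
  rewrite ler_piMr ?rnorm_basis//.
  by apply: prodr_ge0 => i _; exact: rnorm_ge0.
- move=> E m M' M'0 mm mM'.
  have [M M0 ME] : exists2 M : R, 0 <= M & M' = M%:C.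
    exists (complex.Re M'); last by rewrite RRe_real// ger0_real.
    by move: M'0; rewrite lecE => /andP[].
  rewrite ME in mM' *.
  have [lT _] := ell1_ext_bounded_linear (ptensor_bd M0 mM').
  set T := ell1_ext _ in lT.
  pose f (q : bquot N) := T (repr q).
  have fE x : f (bpi N x) = T x.
    apply/eqP; rewrite -subr_eq0 -(linearBf lT); apply/eqP.
    exact: (brepr_pi N x _ _ _ M0 mm mM').
  exists f; last by move=> a; rewrite fE /T (ptensor_T M0 mm mM').
  split.
    move=> c; elim/bquotW=> x; elim/bquotW=> y.
    by rewrite -bpiZ -bpiD !fE lT.
  move=> q; rewrite norm_leP bnormE; apply: ge0_le_eps => e e0.
  have k0 : 0 < M + 1 by rewrite ltr_wpDl.
  have [x <- xq] := qnorm_lift q (divr_gt0 e0 k0).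
  rewrite fE (le_trans (ell1_ext_le (ptensor_bd M0 mM') _))//.
  rewrite (le_trans (ler_wpM2l M0 (ltW xq)))// mulrDr lerD2l.
  by rewrite mulrA ler_pdivrMr// mulrC ler_wpM2l// ?ltW// ltrDl.
- move=> E f g bf bg fg.
  have bc (h : bquot N -> E) : bounded_linear h -> bounded_linear (h \o bpi N).
    move=> /bounded_linear_rnorm[lh [M M0 hM]]; apply/bounded_linear_rnorm.
    split; first by move=> c x y /=; rewrite bpiD bpiZ lh.
    exists M => // x; rewrite (le_trans (hM _))// ler_wpM2l//.
    by rewrite bnormE qnorm_le.
  have fg' : f \o bpi N = g \o bpi N.
    apply: ell1_ext_eq => [||a]; [exact: bc..|].
    by rewrite /= ptensor_basis fg.
  by apply/funext; elim/bquotW => x; exact: (congr1 (@^~ x) fg').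
Qed.

End existence.

Theorem ptensor_exists (V : completeNormedModType C) :
  exists P : completeNormedModType C, exists tau : ('I_n -> V) -> P,
    is_ptensor tau.
Proof. by eexists; eexists; exact: ptensor_tau. Qed.

End ptensor.

Section tpow.
Variable R : realType.
Local Notation C := R[i].
Variables (V : completeNormedModType C) (n : nat).

Definition tpow : completeNormedModType C :=
  projT1 (cid (ptensor_exists n V)).

Definition tens : ('I_n -> V) -> tpow :=
  projT1 (cid (projT2 (cid (ptensor_exists n V)))).

Lemma tensP : is_ptensor tens.
Proof. exact: (projT2 (cid (projT2 (cid (ptensor_exists n V))))). Qed.

Variable E : completeNormedModType C.

(* The bounded linear map with tlift m (tens a) = m a; the default value 0 is
   only taken when m is not bounded multilinear (see tliftP). *)
Definition tlift (m : ('I_n -> V) -> E) : tpow -> E :=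
  xget (fun=> 0) [set f | bounded_linear f /\ forall a, f (tens a) = m a].

Lemma tliftP (m : ('I_n -> V) -> E) : bounded_multilinear m ->
  bounded_linear (tlift m) /\ forall a, tlift m (tens a) = m a.
Proof.
move=> [mm [M M0 mM]].
apply: (xgetPex (fun=> 0)
  (P := [set f | bounded_linear f /\ forall a, f (tens a) = m a])).
have [f [lf fM] fm] := ptensor_ext tensP M0 mm mM.
by exists f; split=> //; split=> //; exists M.
Qed.

Lemma tlift_bounded_linear (m : ('I_n -> V) -> E) :
  bounded_multilinear m -> bounded_linear (tlift m).
Proof. by move=> /tliftP[]. Qed.

Lemma tlift_tens (m : ('I_n -> V) -> E) :
  bounded_multilinear m -> forall a, tlift m (tens a) = m a.
Proof. by move=> /tliftP[]. Qed.

Lemma tens_bounded_multilinear : bounded_multilinear tens.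
Proof.
split; first exact: ptensor_multilinear tensP.
by exists 1 => // a; rewrite mul1r; exact: ptensor_le tensP a.
Qed.

End tpow.

Section bounded_multilinear_theory.
Variables (R : realType) (n : nat).
Local Notation C := R[i].
Variables (V W : completeNormedModType C).

Lemma bounded_multilinearD (f g : ('I_n -> V) -> W) :
  bounded_multilinear f -> bounded_multilinear g ->
  bounded_multilinear (fun a => f a + g a).
Proof.
move=> [fm [M M0 fM]] [gm [N N0 gN]]; split.
  by move=> a i c x y; rewrite fm gm scalerDr addrACA.
exists (M + N); first exact: addr_ge0.
by move=> a; rewrite (le_trans (ler_normD _ _))// mulrDl lerD.
Qed.

Lemma bounded_multilinearZ (c : C) (f : ('I_n -> V) -> W) :
  bounded_multilinear f -> bounded_multilinear (fun a => c *: f a).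
Proof.
move=> [fm [M M0 fM]]; split.
  by move=> a i d x y; rewrite fm scalerDr !scalerA mulrC.
exists (`|c| * M); first exact: mulr_ge0.
by move=> a; rewrite normrZ -mulrA ler_wpM2l.
Qed.

Lemma bounded_multilinear_sum (I : Type) (s : seq I)
    (F : I -> ('I_n -> V) -> W) :
  (forall i, bounded_multilinear (F i)) ->
  bounded_multilinear (fun a => \sum_(i <- s) F i a).
Proof.
move=> Fm; elim: s => [|i s ih].
  have -> : (fun a => \sum_(i <- [::]) F i a) = (fun=> 0 : W).
    by apply/funext => a; rewrite big_nil.
  split; first by move=> *; rewrite scaler0 addr0.
  by exists 0 => // a; rewrite normr0 mul0r.
have -> : (fun a => \sum_(i <- i :: s) F i a) =
    (fun a => F i a + \sum_(i <- s) F i a).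
  by apply/funext => a; rewrite big_cons.
exact: bounded_multilinearD.
Qed.

Lemma bounded_multilinear_comp (U : completeNormedModType C) (f : U -> V)
    (m : ('I_n -> V) -> W) :
  bounded_linear f -> bounded_multilinear m ->
  bounded_multilinear (fun a => m (f \o a)).
Proof.
move=> [lf [N fN]] [mm [M M0 mM]].
have updE (a : 'I_n -> U) i x : f \o update a i x = update (f \o a) i (f x).
  by apply/funext => j; rewrite /update/=; case: eqP.
split; first by move=> a i c x y; rewrite !updE lf mm.
have {}fN x : `|f x| <= `|N| * `|x|.
  apply: (le_trans (fN x)); have := le_trans (normr_ge0 _) (fN x) => h.
  by rewrite -[leLHS]ger0_norm// normrM normr_id.
exists (M * `|N| ^+ n) => [|a]; first by rewrite mulr_ge0 ?exprn_ge0.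
rewrite (le_trans (mM _))// -mulrA ler_wpM2l//.
rewrite -[n in X in _ <= X * _]card_ord -prodr_const -big_split/=.
by apply: ler_prod => i _; rewrite normr_ge0 fN.
Qed.

End bounded_multilinear_theory.

Section tmap.
Variable R : realType.
Local Notation C := R[i].
Variables (V W : completeNormedModType C).

Definition tmap (n : nat) (f : V -> W) : tpow V n -> tpow W n :=
  tlift (fun a => tens (f \o a)).

Arguments tmap : clear implicits.

Lemma tmapP (n : nat) (f : V -> W) : bounded_linear f ->
  bounded_linear (tmap n f) /\ forall a, tmap n f (tens a) = tens (f \o a).
Proof.
move=> bf; apply: tliftP; apply: bounded_multilinear_comp => //.
exact: tens_bounded_multilinear.
Qed.

End tmap.

Arguments tmap {R V W} n f _.

(* Not necessarily unital. *)
HB.mixin Record isBanachAlgebra (K : numFieldType) A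
    of CompleteNormedModule K A := {
  bmul : A -> A -> A;
  bmulA : associative bmul;
  bmul_linearl : forall y, linear (bmul^~ y);
  bmul_linearr : forall x, linear (bmul x);
  bmul_norm_le : forall x y, `|bmul x y| <= `|x| * `|y|
}.

#[short(type="banachAlgType")]
HB.structure Definition BanachAlgebra (K : numFieldType) :=
  {A of CompleteNormedModule K A & isBanachAlgebra K A}.

Section hochschild.
Variables (R : realType) (A : banachAlgType R[i]).
Local Notation C := R[i].

Definition hochschild_chain (n : nat) : completeNormedModType C :=
  tpow A n.+1.

(* face j a = (a_0, ..., a_j a_(j+1), ..., a_(n+1)) and
   last_face a = (a_(n+1) a_0, a_1, ..., a_n). *)
Definition face (n : nat) (j : 'I_n.+1) (a : 'I_n.+2 -> A) : 'I_n.+1 -> A :=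
  fun i => if (i < j)%N then a (widen_ord (leqnSn n.+1) i)
           else if i == j then bmul (a (widen_ord (leqnSn n.+1) i))
                                    (a (lift ord0 i))
           else a (lift ord0 i).

Definition last_face (n : nat) (a : 'I_n.+2 -> A) : 'I_n.+1 -> A :=
  fun i => if i == ord0 then bmul (a ord_max) (a ord0)
           else a (widen_ord (leqnSn n.+1) i).

Definition hochschild_tens (n : nat) (a : 'I_n.+2 -> A) : hochschild_chain n :=
  \sum_(j < n.+1) (-1) ^+ j *: tens (face j a)
    + (-1) ^+ n.+1 *: tens (last_face a).

(* hochschild_dE below gives its values on elementary tensors. *)
Definition hochschild_d (n : nat) :
    hochschild_chain n.+1 -> hochschild_chain n :=
  tlift (@hochschild_tens n).

Section contract.
Variables (n : nat) (k : 'I_n.+2) (j : 'I_n.+1) (op : A -> A -> A).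
Hypotheses (opl : forall y, linear (op^~ y)) (opr : forall x, linear (op x)).
Hypothesis op_le : forall x y, `|op x y| <= `|x| * `|y|.

Let contract (a : 'I_n.+2 -> A) : 'I_n.+1 -> A :=
  fun i => if i == j then op (a (lift k i)) (a k) else a (lift k i).

Lemma contract_bounded_multilinear :
  bounded_multilinear (fun a => tens (contract a)).
Proof.
have [tm [_ _ _]] := tens_bounded_multilinear A n.+1.
split.
  move=> a i c x y; have [i0 ->|->] := unliftP k i.
    have [ij|ij] := eqVneq i0 j.
      have cE z : contract (update a (lift k i0) z) =
          update (contract a) i0 (op z (a k)).
        apply/funext => l; rewrite /contract /update (inj_eq lift_inj) -ij.
        by case: (l == i0); rewrite // (negPf (neq_lift k i0)).
      by rewrite !cE (opl (a k)) tm.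
    have cE z : contract (update a (lift k i0) z) = update (contract a) i0 z.
      apply/funext => l; rewrite /contract /update (inj_eq lift_inj).
      rewrite (negPf (neq_lift k i0)).
      by have [->|//] := eqVneq l i0; rewrite (negPf ij).
    by rewrite !cE tm.
  have cE z : contract (update a k z) = update (contract a) j (op (a (lift k j)) z).
    apply/funext => l; rewrite /contract /update eqxx.
    rewrite [lift k l == k]eq_sym (negPf (neq_lift k l)).
    by have [->|//] := eqVneq l j.
  by rewrite !cE opr tm.
exists 1 => // a; rewrite mul1r (le_trans (ptensor_le (tensP A n.+1) _))//.
rewrite (bigD1 j)//= [leRHS](bigD1_ord k)//= [X in _ <= _ * X](bigD1 j)//= mulrA.
rewrite ler_pM ?prodr_ge0//.
  by rewrite /contract eqxx mulrC op_le.
by apply: ler_prod => i ij; rewrite /contract (negPf ij) normr_ge0 lexx.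
Qed.

End contract.

Lemma hochschild_tens_bounded_multilinear (n : nat) :
  bounded_multilinear (@hochschild_tens n).
Proof.
apply: bounded_multilinearD; last first.
  apply: bounded_multilinearZ.
  have := @contract_bounded_multilinear n ord_max ord0 (fun x y => bmul y x)
    bmul_linearr bmul_linearl.
  rewrite (_ : (fun a => _) = (fun a => tens (last_face a))); last first.
    apply/funext => a; congr tens; apply/funext => i; rewrite /last_face.
    have -> : lift ord_max i = widen_ord (leqnSn n.+1) i.
      by apply/val_inj; rewrite /= /bump leqNgt ltn_ord.
    case: eqP => // ->; congr (bmul _ (a _)); exact/val_inj.
  by apply=> x y; rewrite mulrC bmul_norm_le.
apply: bounded_multilinear_sum => j; apply: bounded_multilinearZ.
have := @contract_bounded_multilinear n (lift ord0 j) j bmul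
  bmul_linearl bmul_linearr bmul_norm_le.
rewrite (_ : (fun a => _) = (fun a => tens (face j a)))//.
apply/funext => a; congr tens; apply/funext => i; rewrite /face.
have w : (i <= j)%N -> lift (lift ord0 j) i = widen_ord (leqnSn n.+1) i.
  by move=> ij; apply/val_inj; rewrite /= /bump/= ltnNge ij.
have l : (j < i)%N -> lift (lift ord0 j) i = lift ord0 i.
  by move=> ij; apply/val_inj; rewrite /= /bump/= !add1n ij.
have [ij|ij] := eqVneq i j; first by rewrite w ?ij// ltnn.
case: ltngtP => [ij'|ij'|/val_inj e]; first by rewrite w// ltnW.
  by rewrite l.
by rewrite e eqxx in ij.
Qed.

Lemma hochschild_d_bounded_linear (n : nat) : bounded_linear (@hochschild_d n).
Proof. exact/tlift_bounded_linear/hochschild_tens_bounded_multilinear. Qed.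

Lemma hochschild_dE (n : nat) (a : 'I_n.+2 -> A) :
  hochschild_d (tens a) =
  \sum_(j < n.+1) (-1) ^+ j *: tens (face j a)
    + (-1) ^+ n.+1 *: tens (last_face a).
Proof. exact/tlift_tens/hochschild_tens_bounded_multilinear. Qed.

End hochschild.

Section ell1_algebra.
Variables (R : realType) (H : semigroupType).
Local Notation C := R[i].
Local Notation l1 := (ell1 R H).

(* Both sums converge absolutely in the Banach space ell1(H), so this is
   \sum_(s, t) x_s y_t e_(st). *)
Definition ell1_conv (x y : l1) : l1 :=
  summability.sum (fun s => x s *:
    summability.sum (fun t => y t *: ell1_basis R (s * t)%g)).

Lemma ell1_convE (x y : l1) : ell1_conv x y =
  ell1_ext (fun s => ell1_ext (fun t => ell1_basis R (s * t)%g) y) x.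
Proof. by []. Qed.

Let inner_le (y : l1) s :
  rnorm (ell1_ext (fun t => ell1_basis R (s * t)%g) y) <= rnorm y.
Proof.
rewrite -[leRHS]mul1r; apply: ell1_ext_le => t; exact: rnorm_basis.
Qed.

Fact ell1_conv_bll (y : l1) : bounded_linear (ell1_conv^~ y).
Proof. exact: (ell1_ext_bounded_linear (inner_le y)). Qed.

Fact ell1_conv_linearl (y : l1) : linear (ell1_conv^~ y).
Proof. by have [] := ell1_conv_bll y. Qed.

Fact ell1_conv_linearr (x : l1) : linear (ell1_conv x).
Proof.
move=> c y z; rewrite !ell1_convE.
rewrite -usum_linear; [|exact: (ell1_ext_asummable (inner_le _))..].
congr (summability.sum _); apply/funext => s.
rewrite (ell1_ext_linear (fun t => rnorm_basis R (s * t)%g)).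
by rewrite scalerDr !scalerA mulrC.
Qed.

Fact ell1_conv_rnorm_le (x y : l1) :
  rnorm (ell1_conv x y) <= rnorm x * rnorm y.
Proof. by rewrite mulrC; apply: ell1_ext_le; exact: inner_le. Qed.

Fact ell1_conv_norm_le (x y : l1) : `|ell1_conv x y| <= `|x| * `|y|.
Proof. by rewrite !rnormE -rmorphM lecR ell1_conv_rnorm_le. Qed.

Lemma ell1_conv_basis s t :
  ell1_conv (ell1_basis R s) (ell1_basis R t) = ell1_basis R (s * t)%g.
Proof. by rewrite ell1_convE !ell1_ext_basis. Qed.

Fact ell1_conv_blr (x : l1) : bounded_linear (ell1_conv x).
Proof.
apply/bounded_linear_rnorm; split; first exact: ell1_conv_linearr.
by exists (rnorm x) => [|y]; [exact: rnorm_ge0|exact: ell1_conv_rnorm_le].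
Qed.

Let ell1_convA2 s t z :
  ell1_conv (ell1_basis R s) (ell1_conv (ell1_basis R t) z) =
  ell1_conv (ell1_basis R (s * t)%g) z.
Proof.
suff E : ell1_conv (ell1_basis R s) \o ell1_conv (ell1_basis R t) =
    ell1_conv (ell1_basis R (s * t)%g) by exact: (congr1 (@^~ z) E).
apply: ell1_ext_eq => [||u]; [|exact: ell1_conv_blr|].
  by apply: bounded_linear_comp; exact: ell1_conv_blr.
by rewrite /= !ell1_conv_basis mulgA.
Qed.

Let ell1_convA1 s y z :
  ell1_conv (ell1_basis R s) (ell1_conv y z) =
  ell1_conv (ell1_conv (ell1_basis R s) y) z.
Proof.
suff E : ell1_conv (ell1_basis R s) \o (ell1_conv^~ z) =
    (ell1_conv^~ z) \o ell1_conv (ell1_basis R s) by exact: (congr1 (@^~ y) E).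
apply: ell1_ext_eq => [||t].
- by apply: bounded_linear_comp; [exact: ell1_conv_blr|exact: ell1_conv_bll].
- by apply: bounded_linear_comp; [exact: ell1_conv_bll|exact: ell1_conv_blr].
- by rewrite /= ell1_convA2 ell1_conv_basis.
Qed.

Fact ell1_convA : associative ell1_conv.
Proof.
move=> x y z.
suff E : ell1_conv^~ (ell1_conv y z) = (ell1_conv^~ z) \o (ell1_conv^~ y)
  by exact: (congr1 (@^~ x) E).
apply: ell1_ext_eq => [||s]; first exact: ell1_conv_bll.
  by apply: bounded_linear_comp; exact: ell1_conv_bll.
by rewrite /= ell1_convA1.
Qed.

HB.instance Definition _ := isBanachAlgebra.Build C l1
  ell1_convA ell1_conv_linearl ell1_conv_linearr ell1_conv_norm_le.

End ell1_algebra.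

Definition ell1_map (R : realType) (X Y : choiceType) (theta : X -> Y)
    (f : ell1 R X) : ell1 R Y :=
  summability.sum (fun x => f x *: ell1_basis R (theta x)).

Lemma ell1_map_bounded_linear (R : realType) (X Y : choiceType) (theta : X -> Y) :
  bounded_linear (@ell1_map R X Y theta).
Proof. exact: (ell1_ext_bounded_linear (fun x => rnorm_basis R (theta x))). Qed.

Lemma ell1_map_basis (R : realType) (X Y : choiceType) (theta : X -> Y) x :
  ell1_map theta (ell1_basis R x) = ell1_basis R (theta x).
Proof. exact: ell1_ext_basis. Qed.

Lemma ell1_map_conv (R : realType) (H K : semigroupType) (theta : H -> K) :
  {morph theta : s t / (s * t)%g} ->
  {morph @ell1_map R H K theta : x y / bmul x y}.
Proof.
move=> thetaM x y; have bm := ell1_map_bounded_linear R theta.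
suff E : ell1_map theta \o (@ell1_conv R H)^~ y =
    (@ell1_conv R K)^~ (ell1_map theta y) \o ell1_map theta
  by exact: (congr1 (@^~ x) E).
apply: ell1_ext_eq => [||s].
- by apply: bounded_linear_comp => //; exact: ell1_conv_bll.
- by apply: bounded_linear_comp => //; exact: ell1_conv_bll.
rewrite /= ell1_map_basis.
suff E : ell1_map theta \o ell1_conv (ell1_basis R s) =
    ell1_conv (ell1_basis R (theta s)) \o ell1_map theta
  by exact: (congr1 (@^~ y) E).
apply: ell1_ext_eq => [||t].
- by apply: bounded_linear_comp => //; exact: ell1_conv_blr.
- by apply: bounded_linear_comp => //; exact: ell1_conv_blr.
by rewrite /= ell1_conv_basis !ell1_map_basis ell1_conv_basis thetaM.
Qed.

HB.mixin Record Monoid_isSemilattice H of monoid.Monoid H := {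
  semilattice_mulC : commutative (@monoid.mul H);
  semilattice_mulxx : forall x : H, (x * x)%g = x
}.

#[short(type="unitalSemilatticeType")]
HB.structure Definition UnitalSemilattice :=
  {H of monoid.Monoid H & Monoid_isSemilattice H}.

Section split_exact.
Variables (R : realType) (X : nat -> completeNormedModType R[i]).
Variable d : forall n, X n.+1 -> X n.

Definition exact_ge1 : Prop :=
  forall n (x : X n.+1), d x = 0 <-> exists y : X n.+2, d y = x.

(* A bounded linear contracting homotopy in degrees 1 and above. *)
Definition split_ge1 : Prop :=
  exists s : forall n, X n -> X n.+1,
    (forall n, bounded_linear (@s n)) /\
    (forall n (x : X n.+1), d (s n.+1 x) + s n (d x) = x).

Definition split_exact_ge1 : Prop := exact_ge1 /\ split_ge1.

End split_exact.

(* Main.v *)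
Require Import Defs.
From HB Require Import structures.
From mathcomp Require Import all_boot all_order all_algebra.
From mathcomp Require Import zify complex boolp.
From mathcomp Require Import reals topology normedtype.

Set Implicit Arguments.
Unset Strict Implicit.
Unset Printing Implicit Defensive.

Import Order.TTheory GRing.Theory Num.Theory.
Import numFieldNormedType.Exports.

Local Open Scope ring_scope.

(** The proof is an acyclic-models argument with explicit models.

    The n-fold projective tensor power of ell1(X) is the free Banach space on
    X^n ([basis_tens_extP], [basis_tens_ext_eq]), so a bounded linear map out of
    C_n(ell1(H)) amounts to a uniformly bounded choice of a value at each basis
    tensor e_x = e_(x_0) (x) ... (x) e_(x_n). The homotopy is built by recursion
    on n, starting from sigma_0 = 0. This start is possible because ell1(H) is
    commutative, so that d_0 = 0 and every 1-chain is a cycle. Once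
    d sigma_n + sigma_(n-1) d = id is known,
    the chain z = e_x - sigma_n (d e_x) is a cycle, because d d = 0
    ([hochschild_dd]), and sigma_(n+1) e_x has to be a chain bounded by z,
    chosen naturally in x and with a norm bounded independently of x and H.

    Such a choice exists because z only involves the finite-dimensional algebra
    generated by the e_(x_i). The e_(x_i) are commuting idempotents, so this
    algebra is diagonalized by the products p of the e_(x_i) and their
    complements 1 - e_(x_i) ([atoms]), which are idempotents of sum 1. On chains
    with entries diagonalized by these p, the map
      a_0 (x) a_1 (x) ...  |->  sum over p of a_0 p (x) p (x) a_1 (x) ...
    satisfies d s + s d = id in positive degrees ([contraction_homotopy]):
    the diagonal element, the sum of the p (x) p, multiplies to 1, and
    it commutes with every diagonalized element. Hence sigma_(n+1) e_x = s z
    works ([homotopy], [homotopyP]).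

    The formula for s commutes with algebra homomorphisms, which carry atoms to
    atoms; this is naturality ([homotopy_natural]). Its norm is at most the sum
    of the |p|^2, hence at most 5^(n+2) on the n + 2 entries of e_x
    ([atoms_norm]); this is uniform boundedness. *)

(** * Bounded linear maps on projective tensor powers *)

Section bounded_maps.
Variable R : realType.
Local Notation C := R[i].

Lemma bounded_linearD (V W : normedModType C) (f g : V -> W) :
  bounded_linear f -> bounded_linear g -> bounded_linear (fun x => f x + g x).
Proof.
move=> [lf [M fM]] [lg [N gN]]; split.
  by move=> c x y; rewrite lf lg scalerDr addrACA.
exists (M + N) => x; rewrite (le_trans (ler_normD _ _))// mulrDl lerD//.
Qed.

Lemma bounded_linear_id (V : normedModType C) : bounded_linear (@id V).
Proof. by split=> //; exists 1 => x; rewrite mul1r. Qed.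

Lemma bounded_linear0 (V W : normedModType C) :
  bounded_linear (fun _ : V => 0 : W).
Proof.
split; first by move=> c x y; rewrite scaler0 addr0.
by exists 0 => x; rewrite normr0 mul0r.
Qed.

Lemma tpow_ext_eq (V E : completeNormedModType C) (n : nat)
    (f g : tpow V n -> E) : bounded_linear f -> bounded_linear g ->
  (forall a, f (tens a) = g (tens a)) -> f = g.
Proof. exact: ptensor_uniq (tensP V n) E f g. Qed.

(** The extension provided by the universal property has norm at most M, and by
    uniqueness it is [tlift m]. *)
Lemma tlift_le (V E : completeNormedModType C) (n : nat)
    (m : ('I_n -> V) -> E) (M : C) : 0 <= M -> multilinear m -> mbounded M m ->
  forall x, `|tlift m x| <= M * `|x|.
Proof.
move=> M0 mm mM x.
have bm : bounded_multilinear m by split=> //; exists M.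
have [f [lf fM] fm] := ptensor_ext (tensP V n) M0 mm mM.
suff -> : tlift m = f by [].
apply: tpow_ext_eq; first exact: tlift_bounded_linear.
  by split=> //; exists M.
by move=> a; rewrite tlift_tens.
Qed.

Lemma tens_slot_bounded_linear (V : completeNormedModType C) (n : nat)
    (a : 'I_n -> V) (i : 'I_n) :
  bounded_linear (fun z => tens (update a i z)).
Proof.
split; first by move=> c x y; exact: ptensor_multilinear (tensP V n) a i c x y.
exists (\prod_(j | j != i) `|a j|) => z.
rewrite (le_trans (ptensor_le (tensP V n) _))// (bigD1 i)//= mulrC.
rewrite {2}/update eqxx ler_wpM2r// le_eqVlt; apply/orP; left; apply/eqP.
by apply: eq_bigr => j ji; rewrite /update (negPf ji).
Qed.

End bounded_maps.

(** * Tensor powers of ell1(X) are free on basis tensors *)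

Section basis_tensors.
Local Open Scope complex_scope.
Variables (R : realType) (X : choiceType).
Local Notation C := R[i].
Local Notation l1 := (ell1 R X).

Definition basis_tens (n : nat) (x : 'I_n -> X) : tpow l1 n :=
  tens (fun i => ell1_basis R (x i)).

Lemma ell1_basis_norm (x : X) : `|ell1_basis R x| <= 1.
Proof. by rewrite rnormE -[leRHS](rmorph1 (real_complex R)) lecR rnorm_basis. Qed.

Lemma basis_tens_le n (x : 'I_n -> X) : `|basis_tens x| <= 1.
Proof.
rewrite (le_trans (ptensor_le (tensP _ _) _))//; apply: prodr_ile1 => i _.
by rewrite normr_ge0 ell1_basis_norm.
Qed.

(** Slots are released one at a time: [ell1_ext_eq] passes from basis vectors to
    all vectors in one slot. *)
Lemma basis_tens_ext_eq (E : completeNormedModType C) (n : nat)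
    (f g : tpow l1 n -> E) : bounded_linear f -> bounded_linear g ->
  (forall x, f (basis_tens x) = g (basis_tens x)) -> f = g.
Proof.
move=> bf bg fg; apply: tpow_ext_eq => // a.
(* Slots of index at least k still hold basis vectors. *)
suff H k : forall a : 'I_n -> l1,
    (forall i : 'I_n, (k <= i)%N -> exists x, a i = ell1_basis R x) ->
    f (tens a) = g (tens a).
  by apply: (H n) => i; rewrite leqNgt ltn_ord.
elim: k => {a} [|k IH] a aP.
  pose x i := projT1 (cid (aP i (leq0n _))).
  suff -> : a = fun i => ell1_basis R (x i) by exact: fg.
  by apply/funext => i; rewrite /x; case: cid.
have [kn|nk] := ltnP k n; last first.
  by apply: IH => i ki; have := ltn_ord i; lia.
pose i0 := Ordinal kn.
have -> : a = update a i0 (a i0).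
  by apply/funext => j; rewrite /update; case: eqP => [->|].
suff /(congr1 (@^~ (a i0))) : f \o (fun z => tens (update a i0 z)) =
    g \o (fun z => tens (update a i0 z)) by [].
apply: ell1_ext_eq.
- by apply: bounded_linear_comp => //; exact: tens_slot_bounded_linear.
- by apply: bounded_linear_comp => //; exact: tens_slot_bounded_linear.
move=> y /=; apply: IH => i ki; rewrite /update.
case: eqP => [_|/eqP ii0]; first by exists y.
apply: aP; rewrite ltn_neqAle ki andbT.
by apply: contraNneq ii0 => e; exact/eqP/val_inj.
Qed.


Section extension.
Variable E : completeNormedModType C.

Definition icons (T : Type) (n : nat) (x : T) (a : 'I_n -> T) : 'I_n.+1 -> T :=
  fun i => if unlift ord0 i is Some j then a j else x.

Lemma iconsK (T : Type) (n : nat) (a : 'I_n.+1 -> T) :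
  icons (a ord0) (fun i => a (lift ord0 i)) = a.
Proof. by apply/funext => i; rewrite /icons; case: unliftP => [j|] ->. Qed.

(** The sum over x of (a_0 x_0) ... (a_(n-1) x_(n-1)) m(x), taken as an iterated
    sum, so that norm and linearity reduce to those of [ell1_ext] in each slot. *)
Fixpoint multi_ext (n : nat) : (('I_n -> X) -> E) -> ('I_n -> l1) -> E :=
  match n return (('I_n -> X) -> E) -> ('I_n -> l1) -> E with
  | 0 => fun m _ => m (fun i => False_rect X (notF (valP i)))
  | n'.+1 => fun m a =>
      ell1_ext (fun h => multi_ext (fun x => m (icons h x))
                           (fun i => a (lift ord0 i))) (a ord0)
  end.

Lemma multi_ext_le (M : R) : 0 <= M -> forall n (m : ('I_n -> X) -> E),
  (forall x, rnorm (m x) <= M) ->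
  forall a, rnorm (multi_ext m a) <= M * \prod_i rnorm (a i).
Proof.
move=> M0; elim=> [|n IH] m mM a /=; first by rewrite big_ord0 mulr1.
rewrite big_ord_recl [X in _ * X]mulrC mulrA; apply: ell1_ext_le => h.
exact: IH.
Qed.

Lemma multi_ext_multilinear (M : R) : 0 <= M ->
  forall n (m : ('I_n -> X) -> E), (forall x, rnorm (m x) <= M) ->
  multilinear (multi_ext m).
Proof.
move=> M0; elim=> [|n IH] m mM a i c x y; first by case: i.
have mh h z : rnorm (m (icons h z)) <= M by [].
have inner (b : 'I_n -> l1) h := multi_ext_le M0 (mh h) b.
have [j ->|->] := unliftP ord0 i; last first.
  have tl z : (fun k => update a ord0 z (lift ord0 k)) =
      fun k => a (lift ord0 k) by [].
  have hd z : update a ord0 z ord0 = z by rewrite /update eqxx.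
  by rewrite /= !tl !hd (ell1_ext_linear (inner _)).
have tl z : (fun k => update a (lift ord0 j) z (lift ord0 k)) =
    update (fun k => a (lift ord0 k)) j z.
  by apply/funext => k; rewrite /update (inj_eq lift_inj).
have hd z : update a (lift ord0 j) z ord0 = a ord0 by [].
rewrite /= !tl !hd /ell1_ext -usum_linear;
  [|exact: (ell1_ext_asummable (inner _))..].
congr (summability.sum _); apply/funext => h.
by rewrite (IH _ (mh h)) scalerDr !scalerA mulrC.
Qed.

Lemma multi_ext_basis n (m : ('I_n -> X) -> E) x :
  multi_ext m (fun i => ell1_basis R (x i)) = m x.
Proof.
elim: n m x => [|n IH] m x /=; first by congr m; apply/funext => -[].
by rewrite ell1_ext_basis IH iconsK.
Qed.

(** With [basis_tens_ext_eq]: the n-fold tensor power of ell1(X) is the free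
    Banach space on X^n, so a bounded linear map out of it may be prescribed
    arbitrarily, within a uniform bound, on the basis tensors. *)
Definition basis_tens_ext (n : nat) (m : ('I_n -> X) -> E) : tpow l1 n -> E :=
  tlift (multi_ext m).

Lemma basis_tens_extP (M : R) n (m : ('I_n -> X) -> E) : 0 <= M ->
  (forall x, rnorm (m x) <= M) ->
  bounded_linear (basis_tens_ext m) /\
  forall x, basis_tens_ext m (basis_tens x) = m x.
Proof.
move=> M0 mM.
have bm : bounded_multilinear (multi_ext m).
  split; first exact: multi_ext_multilinear mM.
  exists M%:C; first by rewrite ler0c.
  move=> a; rewrite rnormE (eq_bigr (fun i => (rnorm (a i))%:C)).
    by rewrite -rmorph_prod -rmorphM lecR; exact: multi_ext_le.
  by move=> i _; rewrite rnormE.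
split; first exact: tlift_bounded_linear.
by move=> x; rewrite /basis_tens_ext tlift_tens// multi_ext_basis.
Qed.

End extension.
End basis_tensors.

(** * The simplicial identities and d d = 0 *)

Section alternating_sum.
Variables (K : nzRingType) (V : lmodType K).

(** Pairing the terms (i, j) with i < j and (j - 1, i), which carry opposite
    signs. *)
Lemma simplicial_sum0 (N : nat) (T : nat -> nat -> V) :
  (forall i j, (i < j <= N)%N -> T i j = T j.-1 i) ->
  \sum_(j < N.+1) \sum_(i < N) (-1) ^+ (i + j) *: T i j = 0.
Proof.
move=> TT.
rewrite (eq_bigr (fun j : 'I_N.+1 =>
    \sum_(i < N | (i < j)%N) (-1) ^+ (i + j) *: T i j +
    \sum_(i < N | (j <= i)%N) (-1) ^+ (i + j) *: T i j)); last first.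
  move=> j _; rewrite (bigID (fun i : 'I_N => (i < j)%N))/=; congr (_ + _).
  by apply: eq_bigl => i; rewrite -leqNgt.
rewrite big_split/= big_ord_recl big_pred0 ?add0r; last by [].
rewrite [X in _ + X]big_ord_recr/= [X in _ + (_ + X)]big_pred0 ?addr0; last first.
  by move=> i; rewrite leqNgt ltn_ord.
rewrite [X in _ + X](exchange_big_dep predT)//= -big_split big1//= => j _.
rewrite -big_split big1//= => i; rewrite /bump/= add1n ltnS => ij.
rewrite TT/=; last by have := ltn_ord j; lia.
by rewrite [(j + i)%N]addnC addnS exprS mulN1r scaleNr addNr.
Qed.

End alternating_sum.

Section simplicial.
Variables (R : realType) (A : banachAlgType R[i]).
Local Notation C := R[i].
Implicit Types (a b : nat -> A).

(** Tensors and faces are indexed by sequences [nat -> A], of which only the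
    first entries matter; this keeps the simplicial identities free of casts
    between ordinals. *)
Definition seq_tens (n : nat) a : hochschild_chain A n :=
  tens (fun i : 'I_n.+1 => a i).

Lemma eq_seq_tens n a b : (forall k, (k <= n)%N -> a k = b k) ->
  seq_tens n a = seq_tens n b.
Proof. by move=> ab; congr tens; apply/funext => i; apply: ab; rewrite -ltnS. Qed.

Lemma tens_seq n (f : 'I_n.+1 -> A) :
  tens f = seq_tens n (fun k => f (inord k)).
Proof. by congr tens; apply/funext => i; rewrite inord_val. Qed.

(** The cyclic face a_(n+1) a_0, a_1, ..., a_n is the one of index n + 1. *)
Definition seq_face (n j : nat) a : nat -> A := fun k =>
  if (j <= n)%N then
    if (k < j)%N then a k else if k == j then bmul (a k) (a k.+1) else a k.+1
  else if k == 0%N then bmul (a n.+1) (a 0%N) else a k.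

Lemma hochschild_d_seq n a :
  hochschild_d (seq_tens n.+1 a) =
  \sum_(j < n.+2) (-1) ^+ j *: seq_tens n (seq_face n j a).
Proof.
rewrite /seq_tens hochschild_dE [RHS]big_ord_recr/=; congr (_ + _ *: tens _).
  apply: eq_bigr => j _; congr (_ *: tens _); apply/funext => i.
  by rewrite /face /seq_face -[(j <= n)%N]ltnS ltn_ord.
apply/funext => i; rewrite /last_face /seq_face ltnn /= -[i == ord0]/(val i == 0%N).
by congr (if _ then bmul (a _) _ else _).
Qed.

(** The simplicial identities d_i d_j = d_(j-1) d_i for i < j. *)
Lemma seq_face_face n i j a k : (i < j <= n.+2)%N -> (k <= n)%N ->
  seq_face n i (seq_face n.+1 j a) k = seq_face n j.-1 (seq_face n.+1 i a) k.
Proof.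
move=> ijn kn; rewrite /seq_face; case: j ijn => // j ijn /=.
repeat case: ifPn; move=> *; try lia; rewrite ?bmulA.
all: by do ?congr bmul; congr a; lia.
Qed.

Lemma hochschild_dd n (z : hochschild_chain A n.+2) :
  hochschild_d (hochschild_d z) = 0.
Proof.
have bd m := hochschild_d_bounded_linear A m.
suff /(congr1 (@^~ z)) : @hochschild_d R A n \o @hochschild_d R A n.+1 = fun=> 0.
  by [].
apply: tpow_ext_eq; first exact: (bounded_linear_comp (bd n) (bd n.+1)).
  exact: bounded_linear0.
move=> f /=; rewrite tens_seq hochschild_d_seq (linear_sumf (proj1 (bd n))).
under eq_bigr => j _.
  rewrite (linearZf (proj1 (bd n))) hochschild_d_seq scaler_sumr.
  under eq_bigr => i _ do rewrite scalerA -exprD addnC.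
  over.
apply: (simplicial_sum0 (T := fun i j =>
  seq_tens n (seq_face n i (seq_face n.+1 j (fun k => f (inord k)))))).
by move=> i j ij; apply: eq_seq_tens => k kn; exact: seq_face_face.
Qed.

(** d (a_0 (x) a_1) = a_0 a_1 - a_1 a_0. *)
Lemma commutative_hochschild_d0 : commutative (@bmul _ A) ->
  forall z : hochschild_chain A 1, hochschild_d z = 0.
Proof.
move=> mulC z; suff /(congr1 (@^~ z)) : @hochschild_d R A 0 = fun=> 0 by [].
apply: tpow_ext_eq; first exact: hochschild_d_bounded_linear.
  exact: bounded_linear0.
move=> f; rewrite tens_seq hochschild_d_seq !big_ord_recl big_ord0 addr0.
rewrite expr0 expr1 scale1r scaleN1r; apply/eqP; rewrite subr_eq0; apply/eqP.
by apply: eq_seq_tens => k; rewrite leqn0 => /eqP ->; rewrite /seq_face/= mulC.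
Qed.

(** * Chains with entries in a given set *)

Inductive chain_span (S : A -> Prop) (n : nat) : hochschild_chain A n -> Prop :=
| chain_span0 : chain_span S 0
| chain_spanP (c : C) a (z : hochschild_chain A n) :
    (forall k, (k <= n)%N -> S (a k)) -> chain_span S z ->
    chain_span S (c *: seq_tens n a + z).

Lemma chain_span_lin S n (c : C) (y z : hochschild_chain A n) :
  chain_span S y -> chain_span S z -> chain_span S (c *: y + z).
Proof.
move=> Sy Sz; elim: Sy => [|d a y' Sa _ IH]; first by rewrite scaler0 add0r.
by rewrite scalerDr scalerA -addrA; exact: chain_spanP.
Qed.

Lemma chain_span_sum S n (I : eqType) (s : seq I) (F : I -> hochschild_chain A n) :
  (forall i, i \in s -> chain_span S (F i)) ->
  chain_span S (\sum_(i <- s) F i).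
Proof.
elim: s => [|i s IH] FS; first by rewrite big_nil; exact: chain_span0.
rewrite big_cons -[F i]scale1r; apply: chain_span_lin.
  by apply: FS; rewrite mem_head.
by apply: IH => j js; apply: FS; rewrite inE js orbT.
Qed.

Lemma chain_spanZ S n (c : C) (y : hochschild_chain A n) :
  chain_span S y -> chain_span S (c *: y).
Proof.
move=> Sy; rewrite -[_ *: _]addr0; apply: chain_span_lin => //.
exact: chain_span0.
Qed.

Lemma chain_span_tens S n a : (forall k, (k <= n)%N -> S (a k)) ->
  chain_span S (seq_tens n a).
Proof.
move=> Sa; rewrite -[seq_tens n a]addr0 -[seq_tens n a]scale1r.
by apply: chain_spanP => //; exact: chain_span0.
Qed.

Lemma chain_span_map S S' n m (f : hochschild_chain A n -> hochschild_chain A m) :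
  linear f ->
  (forall a, (forall k, (k <= n)%N -> S (a k)) ->
    chain_span S' (f (seq_tens n a))) ->
  forall z, chain_span S z -> chain_span S' (f z).
Proof.
move=> lf fS z; elim=> [|c a y Sa _ IH]; first by rewrite (linearf0 lf); exact: chain_span0.
by rewrite lf; apply: chain_span_lin => //; exact: fS.
Qed.

Lemma chain_span_eq S n (E : normedModType C) (f g : hochschild_chain A n -> E) :
  linear f -> linear g ->
  (forall a, (forall k, (k <= n)%N -> S (a k)) ->
    f (seq_tens n a) = g (seq_tens n a)) ->
  forall z, chain_span S z -> f z = g z.
Proof.
move=> lf lg fg z; elim=> [|c a y Sa _ IH]; first by rewrite !linearf0.
by rewrite lf lg IH fg.
Qed.

Lemma hochschild_d_span S n : (forall x y, S x -> S y -> S (bmul x y)) ->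
  forall z : hochschild_chain A n.+1,
    chain_span S z -> chain_span S (hochschild_d z).
Proof.
move=> SM; apply: chain_span_map.
  exact: (proj1 (hochschild_d_bounded_linear A n)).
move=> a Sa; rewrite hochschild_d_seq; apply: chain_span_sum => j _.
apply: chain_spanZ; apply: chain_span_tens => k kn; rewrite /seq_face.
by repeat case: ifPn => ?; do ?apply: SM; apply: Sa; lia.
Qed.

(** * The contraction given by a family of idempotents *)

Section contraction.
Variable P : seq A.

Definition insert_idem (p : A) a : nat -> A := fun k =>
  match k with 0 => bmul (a 0%N) p | 1 => p | k'.+2 => a k'.+1 end.

Definition contract_tens n (f : 'I_n.+1 -> A) : hochschild_chain A n.+1 :=
  \sum_(p <- P) seq_tens n.+1 (insert_idem p (fun k => f (inord k))).

Definition contraction n : hochschild_chain A n -> hochschild_chain A n.+1 :=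
  tlift (@contract_tens n).

Lemma contract_tens_multilinear n : multilinear (@contract_tens n).
Proof.
move=> f i c x y; rewrite /contract_tens scaler_sumr -big_split/=.
apply: eq_bigr => p _.
pose g : 'I_n.+2 -> A := fun k => insert_idem p (fun k => f (inord k)) k.
have [i0|i0] := eqVneq i ord0.
  have E z : seq_tens n.+1 (insert_idem p (fun k => update f i z (inord k))) =
      tens (update g ord0 (bmul z p)).
    congr tens; apply/funext => -[[|[|k]] kn]//=; rewrite /update i0.
      by rewrite -[inord 0 == ord0]/(nat_of_ord (inord 0) == 0%N) inordK.
    by rewrite -[inord _ == ord0]/(nat_of_ord (inord _) == 0%N) inordK.
  by rewrite !E bmul_linearl; exact: ptensor_multilinear (tensP _ _) _ _ _ _ _.
have E z : seq_tens n.+1 (insert_idem p (fun k => update f i z (inord k))) =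
    tens (update g (lift ord0 i) z).
  congr tens; apply/funext => -[[|[|k]] kn]//=; rewrite /update.
  - rewrite -[inord 0 == i]/(nat_of_ord (inord 0) == nat_of_ord i) inordK//.
    by rewrite eq_sym -[nat_of_ord i == _]/(i == ord0) (negPf i0).
  - by rewrite -[_ == lift ord0 i]/(1 == bump 0 i)%N /bump/= add1n eqSS eq_sym
      -[nat_of_ord i == _]/(i == ord0) (negPf i0).
  - by rewrite -[inord _ == i]/(nat_of_ord (inord _) == nat_of_ord i) inordK.
by rewrite !E; exact: ptensor_multilinear (tensP _ _) _ _ _ _ _.
Qed.

(** Each p enters two slots, hence the squares. *)
Lemma contract_tens_mbounded n :
  mbounded (\sum_(p <- P) `|p| ^+ 2) (@contract_tens n).
Proof.
move=> f; rewrite (le_trans (ler_norm_sum _ _ _))// mulr_suml.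
apply: ler_sum => p _; rewrite (le_trans (ptensor_le (tensP _ _) _))//.
rewrite big_ord_recl [X in _ * X]big_ord_recl/= [X in _ <= _ * X]big_ord_recl.
rewrite (eq_bigr (fun i : 'I_n => `|f (lift ord0 i)|)); last first.
  move=> i _; congr (`|f _|); apply/val_inj.
  by rewrite /= inordK add0n ?ltnS.
rewrite !mulrA ler_wpM2r ?prodr_ge0//.
rewrite (_ : inord 0 = ord0); last by apply/val_inj; rewrite /= inordK.
rewrite mulrC expr2.
rewrite -[leRHS]mulrA ler_wpM2l// [leRHS]mulrC bmul_norm_le//.
Qed.

Let sumP_ge0 : 0 <= \sum_(p <- P) `|p| ^+ 2.
Proof. by apply: sumr_ge0 => p _; rewrite exprn_ge0. Qed.

Lemma contract_tens_bounded_multilinear n :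
  bounded_multilinear (@contract_tens n).
Proof.
split; first exact: contract_tens_multilinear.
by exists (\sum_(p <- P) `|p| ^+ 2) => //; exact: contract_tens_mbounded.
Qed.

Lemma contraction_bounded_linear n : bounded_linear (@contraction n).
Proof. exact/tlift_bounded_linear/contract_tens_bounded_multilinear. Qed.

Lemma contraction_le n z :
  `|@contraction n z| <= (\sum_(p <- P) `|p| ^+ 2) * `|z|.
Proof.
apply: tlift_le => //; first exact: contract_tens_multilinear.
exact: contract_tens_mbounded.
Qed.

Lemma contraction_seq n a : contraction (seq_tens n a) =
  \sum_(p <- P) seq_tens n.+1 (insert_idem p a).
Proof.
rewrite /contraction tlift_tens; last exact: contract_tens_bounded_multilinear.
apply: eq_bigr => p _; apply: eq_seq_tens => -[|[|k]] kn //=.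
  by rewrite inordK.
by rewrite inordK.
Qed.

Lemma contraction_span S n : (forall x y, S x -> S y -> S (bmul x y)) ->
  (forall p, p \in P -> S p) ->
  forall z, chain_span S z -> chain_span S (@contraction n z).
Proof.
move=> SM SP; apply: chain_span_map; first exact: (proj1 (contraction_bounded_linear n)).
move=> a Sa; rewrite contraction_seq; apply: chain_span_sum => p pP.
apply: chain_span_tens => -[|[|k]] kn /=; last exact: Sa.
  by apply: SM; [exact: Sa|exact: SP].
exact: SP.
Qed.

(** In a commutative algebra such an x commutes with the diagonal element, the sum
    of the p (x) p: x p (x) p and p (x) p x are the same multiple of p (x) p. *)
Definition diagonalized (x : A) : Prop :=
  forall p, p \in P -> exists c : C, bmul x p = c *: p.

Section homotopy.
Variable u : A.
Hypothesis mulC : commutative (@bmul _ A).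
Hypothesis mul1 : forall x, bmul u x = x.
Hypothesis P_idem : forall p, p \in P -> bmul p p = p.
Hypothesis P_sum : \sum_(p <- P) p = u.

Lemma seq_face_insert n j p a k : (0 < j <= n.+1)%N -> (k <= n.+1)%N ->
  seq_face n.+1 j.+1 (insert_idem p a) k = insert_idem p (seq_face n j a) k.
Proof.
move=> jn kn; rewrite /seq_face; case: k kn => [|[|k]] kn /=;
  repeat case: ifPn => //; move=> *; try lia; rewrite ?bmulA.
all: by do ?congr bmul; try congr a; lia.
Qed.

Lemma seq_tens_slot_linear n a k0 : (k0 <= n)%N ->
  linear (fun x : A => seq_tens n (fun k => if k == k0 then x else a k)).
Proof.
move=> k0n; pose i0 : 'I_n.+1 := inord k0.
have E x : seq_tens n (fun k => if k == k0 then x else a k) =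
    tens (update (fun i : 'I_n.+1 => a i) i0 x).
  congr tens; apply/funext => i; rewrite /update.
  by rewrite -[i == i0]/(nat_of_ord i == nat_of_ord i0) inordK.
by move=> c x y; rewrite !E; exact: (proj1 (tens_slot_bounded_linear _ _)).
Qed.

(** In the boundary of a_0 p (x) p (x) a_1 (x) ..., the face 0 gives
    a_0 p (x) a_1 (x) ... since p p = p. The face 1 is the insertion of p in the
    face 0 of a, as p a_1 and a_1 p are the same multiple of p, and this scalar
    moves between slots. The face j + 1 is the insertion of p in the face j. *)
Lemma insert_homotopy n p a : p \in P -> diagonalized (a 1%N) ->
  hochschild_d (seq_tens n.+2 (insert_idem p a)) +
  \sum_(j < n.+2) (-1) ^+ j *: seq_tens n.+1 (insert_idem p (seq_face n j a)) =
  seq_tens n.+1 (fun k => if k == 0%N then bmul (a 0%N) p else a k).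
Proof.
move=> pP /(_ p pP)[c a1p]; rewrite hochschild_d_seq.
rewrite big_ord_recl [X in _ + X + _]big_ord_recl [X in _ + X]big_ord_recl.
rewrite !expr0 !expr1 !scale1r scaleN1r.
have -> : seq_tens n.+1 (seq_face n.+1 0 (insert_idem p a)) =
    seq_tens n.+1 (fun k => if k == 0%N then bmul (a 0%N) p else a k).
  by apply: eq_seq_tens => -[|k] _; rewrite /seq_face//= -bmulA P_idem.
have -> : seq_tens n.+1 (seq_face n.+1 1 (insert_idem p a)) =
    seq_tens n.+1 (insert_idem p (seq_face n 0 a)).
  transitivity (seq_tens n.+1 (fun k => if k == 1%N then c *: p else
      if k == 0%N then bmul (a 0%N) p else a k)).
    by apply: eq_seq_tens => -[|[|k]] _; rewrite /seq_face//= mulC a1p.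
  rewrite (linearZf (seq_tens_slot_linear _ _))//.
  transitivity (seq_tens n.+1 (fun k => if k == 0%N then c *: bmul (a 0%N) p else
      if k == 1%N then p else a k)).
    rewrite (linearZf (seq_tens_slot_linear _ _))//; congr (_ *: _).
    by apply: eq_seq_tens => -[|[|k]].
  apply: eq_seq_tens => -[|[|k]] _; rewrite /seq_face//=.
  by rewrite -bmulA a1p (linearZf (bmul_linearr _)).
rewrite -!addrA -[RHS]addr0; congr (_ + _).
rewrite [X in _ + X]addrCA addKr -big_split big1//= => j _.
rewrite (@eq_seq_tens _ _ (insert_idem p (seq_face n (bump 0 j) a))).
  by rewrite /bump/= !add1n ![(-1) ^+ _.+1]exprS !mulN1r opprK scaleNr subrr.
move=> k kn; apply: seq_face_insert => //.
by rewrite /bump/= add1n ltnS; have := ltn_ord j; lia.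
Qed.

(** The terms of [insert_homotopy] add up to a_0 (x) a_1 (x) ..., because the
    idempotents have sum u. *)
Lemma contraction_homotopy n (z : hochschild_chain A n.+1) :
  chain_span diagonalized z ->
  hochschild_d (contraction z) + contraction (hochschild_d z) = z.
Proof.
have bc m := contraction_bounded_linear m.
have bd m := hochschild_d_bounded_linear A m.
have b1 := bounded_linear_comp (bd n.+1) (bc n.+1).
have b2 := bounded_linear_comp (bc n) (bd n).
apply: (@chain_span_eq _ _ _ (fun z => hochschild_d (contraction z) +
    contraction (hochschild_d z)) id).
- exact: (proj1 (bounded_linearD b1 b2)).
- by [].
move=> a Da; rewrite contraction_seq hochschild_d_seq.
rewrite (linear_sumf (proj1 (bd _))) (linear_sumf (proj1 (bc _))).
under [X in _ + X]eq_bigr => j _.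
  rewrite (linearZf (proj1 (bc _))) contraction_seq scaler_sumr; over.
rewrite exchange_big -big_split big_seq.
rewrite (eq_bigr (fun p =>
  seq_tens n.+1 (fun k => if k == 0%N then bmul (a 0%N) p else a k))); last first.
  by move=> p pP; apply: insert_homotopy => //; exact: Da.
rewrite -big_seq.
rewrite -(linear_sumf (seq_tens_slot_linear (n := n.+1) a (leq0n _))).
rewrite -(linear_sumf (bmul_linearr _)) P_sum mulC mul1.
by apply: eq_seq_tens => -[].
Qed.

End homotopy.
End contraction.
End simplicial.


(** * Atoms of the algebra generated by commuting idempotents *)

Section atoms.
Variables (R : realType) (A : banachAlgType R[i]).
Local Notation C := R[i].

(** For idempotents X and unit u: the minimal idempotents of the algebra that
    they generate, together with some zeros and repetitions, which do no harm.
    Listing all 2^|X| branches, vanishing or not, makes the list natural in X. *)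
Fixpoint atoms (u : A) (X : seq A) : seq A :=
  if X is x :: X' then
    [seq bmul x p | p <- atoms u X'] ++ [seq p - bmul x p | p <- atoms u X']
  else [:: u].

Lemma atoms_sum u X : \sum_(p <- atoms u X) p = u.
Proof.
elim: X => [|x X IH] /=; first by rewrite big_seq1.
rewrite big_cat/= !big_map -big_split /= -[RHS]IH; apply: eq_bigr => p _.
by rewrite addrC subrK.
Qed.

(** Each further generator x replaces p by x p and p - x p, of norms at most |p|
    and 2 |p|, so the sum of squares grows by a factor of at most 1 + 4. *)
Lemma atoms_norm u X : `|u| <= 1 -> (forall x, x \in X -> `|x| <= 1) ->
  \sum_(p <- atoms u X) `|p| ^+ 2 <= 5 ^+ size X.
Proof.
move=> u1; elim: X => [|x X IH] X1 /=.
  by rewrite big_seq1 expr0 exprn_ile1.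
have /IH {}IH : forall y, y \in X -> `|y| <= 1.
  by move=> y yX; apply: X1; rewrite inE yX orbT.
rewrite big_cat/= !big_map -big_split /= exprS (le_trans _ (ler_wpM2l _ IH))//.
rewrite mulr_sumr; apply: ler_sum => p _.
have xp : `|bmul x p| <= `|p|.
  rewrite (le_trans (bmul_norm_le _ _))// ler_piMl// X1// mem_head//.
have pxp : `|p - bmul x p| <= 2 * `|p|.
  by rewrite (le_trans (ler_normB _ _))// mulr_natl mulr2n lerD2l.
have -> : 5 * `|p| ^+ 2 = `|p| ^+ 2 + (2 * `|p|) ^+ 2.
  by rewrite exprMn -natrX -{2}[_ ^+ 2]mul1r -mulrDl -(natrD _ 1 4).
by rewrite lerD// lerXn2r// ?nnegrE ?mulr_ge0.
Qed.

Record unital_subalgebra (u : A) (S : A -> Prop) : Prop := UnitalSubalgebra {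
  subalg1 : S u;
  subalgM : forall x y, S x -> S y -> S (bmul x y);
  subalgL : forall (c : C) x y, S x -> S y -> S (c *: x + y) }.

Lemma atoms_subalgebra u S X : unital_subalgebra u S ->
  (forall x, x \in X -> S x) -> forall p, p \in atoms u X -> S p.
Proof.
move=> sS; elim: X => [|x X IH] SX p /=; first by rewrite inE => /eqP ->; exact: subalg1 sS.
have Sx : S x by apply: SX; rewrite mem_head.
have {}IH : forall p, p \in atoms u X -> S p.
  by apply: IH => y yX; apply: SX; rewrite inE yX orbT.
rewrite mem_cat => /orP[] /mapP[q /IH Sq ->]; first exact: subalgM sS _ _ Sx Sq.
by rewrite addrC -scaleN1r; apply: (subalgL sS _ _ Sq); exact: subalgM sS _ _ Sx Sq.
Qed.

Section commutative.
Hypothesis mulC : commutative (@bmul _ A).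
Variable u : A.
Hypothesis mul1 : forall x, bmul u x = x.

Let mulrB (x y z : A) : bmul x (y - z) = bmul x y - bmul x z.
Proof. exact: linearBf (bmul_linearr x) y z. Qed.

Let mulCA (x y z : A) : bmul x (bmul y z) = bmul y (bmul x z).
Proof. by rewrite !bmulA (mulC x). Qed.

Let mulACA (x y z t : A) : bmul (bmul x y) (bmul z t) = bmul (bmul x z) (bmul y t).
Proof. by rewrite -!bmulA; congr bmul; rewrite mulCA. Qed.

Lemma atoms_idem X : (forall x, x \in X -> bmul x x = x) ->
  forall p, p \in atoms u X -> bmul p p = p.
Proof.
elim: X => [|x X IH] XX p /=; first by rewrite inE => /eqP ->.
have xx : bmul x x = x by apply: XX; rewrite mem_head.
have {}IH : forall p, p \in atoms u X -> bmul p p = p.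
  by apply: IH => y yX; apply: XX; rewrite inE yX orbT.
rewrite mem_cat => /orP[] /mapP[q /IH qq ->].
  by rewrite mulACA xx qq.
have xq : bmul (bmul x q) q = bmul x q by rewrite -bmulA qq.
rewrite mulrB ![bmul (q - _) _]mulC !mulrB qq mulC xq.
by rewrite mulACA xx qq subrr subr0.
Qed.

Lemma diagonalized_subalgebra P : unital_subalgebra u (@diagonalized R A P).
Proof.
split=> [p pP|x y Dx Dy p pP|c x y Dx Dy p pP].
- by exists 1; rewrite scale1r mul1.
- have [a ap] := Dx p pP; have [b bp] := Dy p pP.
  by exists (b * a); rewrite -bmulA bp (linearZf (bmul_linearr x)) ap scalerA.
- have [a ap] := Dx p pP; have [b bp] := Dy p pP.
  by exists (c * a + b); rewrite bmul_linearl ap bp scalerA scalerDl.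
Qed.

(** The eigenvalue of x at an atom p is 1 or 0 according to the branch, x or
    u - x, taken by p at x. *)
Lemma atoms_diagonalize X : (forall x, x \in X -> bmul x x = x) ->
  forall x, x \in X -> diagonalized (atoms u X) x.
Proof.
elim: X => [//|x X IH] XX y; rewrite inE => /orP[/eqP -> p|yX p] /=;
  rewrite mem_cat => /orP[] /mapP[q qX ->].
- by exists 1; rewrite scale1r bmulA XX// mem_head.
- by exists 0; rewrite scale0r mulrB bmulA XX ?mem_head// subrr.
all: have [|c yq] := IH _ y yX q qX;
  first by move=> z zX; apply: XX; rewrite inE zX orbT.
- by exists c; rewrite mulCA yq (linearZf (bmul_linearr x)).
- by exists c; rewrite mulrB mulCA yq (linearZf (bmul_linearr x)) scalerBr.
Qed.

End commutative.
End atoms.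

(** * Functoriality of the boundary and the contraction *)

Section functoriality.
Variables (R : realType) (A B : banachAlgType R[i]) (f : A -> B).
Hypothesis bf : bounded_linear f.
Hypothesis fM : {morph f : x y / bmul x y}.

Lemma atoms_map u X : map f (atoms u X) = atoms (f u) (map f X).
Proof.
elim: X => //= x X <-; rewrite map_cat -!map_comp.
congr (_ ++ _); apply: eq_map => p /=; first by rewrite fM.
by rewrite (linearBf (proj1 bf)) fM.
Qed.

Let tl n := proj1 (proj1 (tmapP n bf)).

Lemma tmap_seq n a : tmap n.+1 f (seq_tens n a) = seq_tens n (f \o a).
Proof. by rewrite /seq_tens (proj2 (tmapP n.+1 bf)). Qed.

Lemma tmap_hochschild_d n (z : hochschild_chain A n.+1) :
  tmap n.+1 f (hochschild_d z) = hochschild_d (tmap n.+2 f z).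
Proof.
have bt m := proj1 (tmapP m bf).
suff /(congr1 (@^~ z)) : tmap n.+1 f \o @hochschild_d R A n =
    @hochschild_d R B n \o tmap n.+2 f by [].
apply: tpow_ext_eq.
- exact: bounded_linear_comp (bt _) (hochschild_d_bounded_linear _ _).
- exact: bounded_linear_comp (hochschild_d_bounded_linear _ _) (bt _).
move=> a /=; rewrite tens_seq tmap_seq !hochschild_d_seq (linear_sumf (@tl _)).
apply: eq_bigr => j _; rewrite (linearZf (@tl _)) tmap_seq; congr (_ *: _).
by apply: eq_seq_tens => k _; rewrite /seq_face /=; repeat case: ifPn => _ //.
Qed.

Lemma tmap_contraction P n (z : hochschild_chain A n) :
  tmap n.+2 f (contraction P z) = contraction (map f P) (tmap n.+1 f z).
Proof.
have bt m := proj1 (tmapP m bf).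
suff /(congr1 (@^~ z)) : tmap n.+2 f \o @contraction R A P n =
    @contraction R B (map f P) n \o tmap n.+1 f by [].
apply: tpow_ext_eq.
- exact: bounded_linear_comp (bt _) (contraction_bounded_linear _ _).
- exact: bounded_linear_comp (contraction_bounded_linear _ _) (bt _).
move=> a /=; rewrite tens_seq tmap_seq !contraction_seq (linear_sumf (@tl _)) big_map.
by apply: eq_bigr => p _; rewrite tmap_seq; apply: eq_seq_tens => -[|[|k]] _ /=.
Qed.

End functoriality.

(** * The homotopy for a unital semilattice *)

Section semilattice.
Variable R : realType.
Local Notation C := R[i].
Local Notation e := (ell1_basis R).
Implicit Types H K : unitalSemilatticeType.

Lemma ell1_bmul_basis (H : semigroupType) (s t : H) :
  bmul (e s) (e t) = e (s * t)%g.
Proof. exact: ell1_conv_basis. Qed.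

Lemma ell1_bmulC H : commutative (@bmul _ (ell1 R H)).
Proof.
move=> x y.
suff /(congr1 (@^~ x)) : @ell1_conv R H ^~ y = @ell1_conv R H y by [].
apply: ell1_ext_eq; [exact: ell1_conv_bll|exact: ell1_conv_blr|] => s.
suff /(congr1 (@^~ y)) : @ell1_conv R H (e s) = @ell1_conv R H ^~ (e s) by [].
apply: ell1_ext_eq; [exact: ell1_conv_blr|exact: ell1_conv_bll|] => t.
by rewrite !ell1_conv_basis semilattice_mulC.
Qed.

Lemma ell1_bmul1 H (x : ell1 R H) : bmul (e 1%g) x = x.
Proof.
suff /(congr1 (@^~ x)) : @ell1_conv R H (e 1%g) = id by [].
apply: ell1_ext_eq; [exact: ell1_conv_blr|exact: bounded_linear_id|] => s.
by rewrite ell1_conv_basis mul1g.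
Qed.

Definition semilattice_atoms H n (x : 'I_n -> H) : seq (ell1 R H) :=
  atoms (e 1%g) [seq e (x i) | i <- enum 'I_n].

(** The correction subtracted from [basis_tens R x] makes the argument of the
    contraction a cycle. *)
Fixpoint homotopy H n : hochschild_chain (ell1 R H) n ->
    hochschild_chain (ell1 R H) n.+1 :=
  match n with
  | 0 => fun=> 0
  | n'.+1 => basis_tens_ext (fun x : 'I_n'.+2 -> H =>
      contraction (semilattice_atoms x)
        (basis_tens R x - homotopy (hochschild_d (basis_tens R x))))
  end.


Arguments homotopy : simpl never.

Lemma semilattice_atoms_norm H n (x : 'I_n -> H) :
  \sum_(p <- semilattice_atoms x) `|p| ^+ 2 <= 5 ^+ n.
Proof.
rewrite -[n in leRHS]size_enum_ord -(size_map (fun i => e (x i))).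
by apply: atoms_norm => [|_ /mapP[i _ ->]]; exact: ell1_basis_norm.
Qed.

(** The bound does not depend on x; it is what allows [basis_tens_ext] in the
    recursive step. *)
Lemma homotopy_step_bounded H n : bounded_linear (@homotopy H n) ->
  exists2 M : R, 0 <= M & forall x : 'I_n.+2 -> H,
    rnorm (contraction (semilattice_atoms x)
      (basis_tens R x - homotopy (hochschild_d (basis_tens R x)))) <= M.
Proof.
move=> bh; have bd := hochschild_d_bounded_linear (ell1 R H) n.
have /bounded_linear_rnorm[_ [M M0 hM]] := bounded_linear_comp bh bd.
exists (5 ^+ n.+2 * (1 + M)) => [|x]; first by rewrite mulr_ge0 ?exprn_ge0 ?addr_ge0.
have x1 : rnorm (basis_tens R x) <= 1.
  have := basis_tens_le R x.
  by rewrite rnormE -[leRHS](rmorph1 (real_complex R)) lecR.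
set z := _ - _.
have zM : rnorm z <= 1 + M.
  rewrite (le_trans (ler_rnormD _ _))// rnormN lerD//.
  by rewrite (le_trans (hM _))// ler_piMr.
rewrite (@le_trans _ _ (5 ^+ n.+2 * rnorm z))//; last first.
  by rewrite ler_wpM2l ?exprn_ge0.
rewrite -norm_leP rmorphXn rmorph_nat (le_trans (contraction_le _ _))//.
by rewrite ler_wpM2r// semilattice_atoms_norm.
Qed.

Lemma homotopy_bounded_linear H n : bounded_linear (@homotopy H n).
Proof.
elim: n => [|n IH]; first exact: bounded_linear0.
by have [M M0 hM] := homotopy_step_bounded IH; have [] := basis_tens_extP M0 hM.
Qed.

Lemma homotopy_basis H n (x : 'I_n.+2 -> H) :
  homotopy (basis_tens R x : hochschild_chain _ n.+1) =
  contraction (semilattice_atoms x)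
    (basis_tens R x - homotopy (hochschild_d (basis_tens R x))).
Proof.
have [M M0 hM] := homotopy_step_bounded (homotopy_bounded_linear H n).
exact: (proj2 (basis_tens_extP M0 hM) x).
Qed.

Lemma homotopy_natural H K (theta : UMagmaMorphism.type H K) n
    (z : hochschild_chain (ell1 R H) n) :
  tmap n.+2 (ell1_map theta) (homotopy z) =
  homotopy (tmap n.+1 (ell1_map theta) z).
Proof.
have bm := ell1_map_bounded_linear R theta.
have fM : {morph @ell1_map R H K theta : x y / bmul x y}.
  by apply: ell1_map_conv => s t; exact: gmulfM.
have bt m := proj1 (tmapP m bm).
elim: n z => [|n IH] z; first exact: (linearf0 (proj1 (bt _))).
suff /(congr1 (@^~ z)) : tmap n.+3 (ell1_map theta) \o @homotopy H n.+1 =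
    @homotopy K n.+1 \o tmap n.+2 (ell1_map theta) by [].
apply: basis_tens_ext_eq.
- exact: bounded_linear_comp (bt _) (homotopy_bounded_linear _ _).
- exact: bounded_linear_comp (homotopy_bounded_linear _ _) (bt _).
move=> x /=.
have tx : tmap n.+2 (ell1_map theta) (basis_tens R x) = basis_tens R (theta \o x).
  rewrite /basis_tens (proj2 (tmapP _ bm)); congr tens.
  by apply/funext => i /=; rewrite ell1_map_basis.
have ax : map (ell1_map theta) (semilattice_atoms x) = semilattice_atoms (theta \o x).
  rewrite /semilattice_atoms (atoms_map bm fM) ell1_map_basis gmulf1 -map_comp.
  by congr atoms; apply: eq_map => i /=; rewrite ell1_map_basis.
rewrite homotopy_basis (tmap_contraction bm fM) ax (linearBf (proj1 (bt _))).
by rewrite IH (tmap_hochschild_d bm fM) tx -homotopy_basis.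
Qed.

(** The homotopy is explicit only on basis tensors, so the entries of its
    arguments are controlled through basis vectors lying in S. *)
Definition basis_of H (S : ell1 R H -> Prop) (a : ell1 R H) : Prop :=
  S a /\ exists s, a = e s.

Lemma basis_ofM H (S : ell1 R H -> Prop) : unital_subalgebra (e 1%g) S ->
  forall y z, basis_of S y -> basis_of S z -> basis_of S (bmul y z).
Proof.
move=> sS y z [Sy [s ys]] [Sz [t zt]]; split; first exact: subalgM sS _ _ Sy Sz.
by exists (s * t)%g; rewrite ys zt ell1_bmul_basis.
Qed.

Lemma basis_tens_span H S n (x : 'I_n.+1 -> H) : (forall i, S (e (x i))) ->
  chain_span (basis_of S) (basis_tens R x : hochschild_chain _ n).
Proof.
move=> Sx; rewrite /basis_tens tens_seq; apply: chain_span_tens => k kn.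
by split; [exact: Sx|exists (x (inord k))].
Qed.

Lemma chain_spanW H (S S' : ell1 R H -> Prop) n
    (z : hochschild_chain (ell1 R H) n) :
  (forall a, S a -> S' a) -> chain_span S z -> chain_span S' z.
Proof.
move=> SS'; apply: (@chain_span_map _ _ _ _ n n id) => // a Sa.
by apply: chain_span_tens => k kn; apply: SS'; exact: Sa.
Qed.

(** A value of the homotopy involves only the algebra generated by the entries of
    its argument. This is why the contraction attached to x, which contracts
    only what its atoms diagonalize, applies to the correction term. *)
Lemma homotopy_span H (S : ell1 R H -> Prop) n : unital_subalgebra (e 1%g) S ->
  forall z : hochschild_chain (ell1 R H) n,
    chain_span (basis_of S) z -> chain_span S (homotopy z).
Proof.
move=> sS; elim: n => [|n IH]; first by move=> z _; exact: chain_span0.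
apply: chain_span_map; first exact: (proj1 (homotopy_bounded_linear H n.+1)).
move=> a Sa.
have aP (k : 'I_n.+2) : exists s, a k = e s by have [] := Sa k (ltn_ord k).
pose x k := projT1 (cid (aP k)).
have ax (k : 'I_n.+2) : a k = e (x k) by rewrite /x; case: cid.
have -> : seq_tens n.+1 a = basis_tens R x.
  by congr tens; apply/funext => i; rewrite -ax.
have Sx i : S (e (x i)) by rewrite -ax; have [] := Sa i (ltn_ord i).
have spx := basis_tens_span Sx.
rewrite homotopy_basis; apply: contraction_span.
- exact: subalgM sS.
- by apply: (atoms_subalgebra sS) => _ /mapP[i _ ->].
rewrite addrC -scaleN1r; apply: chain_span_lin; last first.
  by apply: chain_spanW spx => y [].
by apply: IH; apply: hochschild_d_span spx; exact: basis_ofM.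
Qed.

Lemma basis_idem H (s : H) : bmul (e s) (e s) = e s.
Proof. by rewrite ell1_bmul_basis semilattice_mulxx. Qed.


(** Once the corrected chain is a cycle, the contraction fills it, since all its
    entries lie in the algebra diagonalized by the atoms of x. *)
Lemma homotopy_basisP H n (x : 'I_n.+2 -> H) :
  let ex : hochschild_chain (ell1 R H) n.+1 := basis_tens R x in
  hochschild_d (ex - homotopy (hochschild_d ex)) = 0 ->
  hochschild_d (homotopy ex) + homotopy (hochschild_d ex) = ex.
Proof.
move=> ex; set z := ex - _ => dz0.
pose X := [seq e (x i) | i <- enum 'I_n.+2].
pose S := diagonalized (semilattice_atoms x).
have mC := @ell1_bmulC H; have m1 := @ell1_bmul1 H.
have XX y : y \in X -> bmul y y = y by case/mapP => i _ ->; exact: basis_idem.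
have sS : unital_subalgebra (e 1%g) S by exact: diagonalized_subalgebra.
have Sx i : S (e (x i)).
  by apply: (atoms_diagonalize mC (u := e 1%g) XX); apply: map_f; rewrite mem_enum.
have Sex : chain_span (basis_of S) ex by exact: basis_tens_span.
have Sz : chain_span S z.
  rewrite /z addrC -scaleN1r; apply: chain_span_lin; last first.
    by apply: chain_spanW Sex => y [].
  by apply: (homotopy_span sS); apply: hochschild_d_span Sex; exact: basis_ofM.
have := contraction_homotopy mC m1 (atoms_idem mC m1 XX) (atoms_sum _ _) Sz.
rewrite dz0 (linearf0 (proj1 (contraction_bounded_linear _ _))) addr0.
by rewrite /ex homotopy_basis => ->; rewrite subrK.
Qed.

(** By induction, d sigma d e_x = d e_x - sigma d d e_x = d e_x, so the corrected
    chain is a cycle; in degree 1 every chain is one. *)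
Lemma homotopyP H n (z : hochschild_chain (ell1 R H) n.+1) :
  hochschild_d (homotopy z) + homotopy (hochschild_d z) = z.
Proof.
have bh m := homotopy_bounded_linear H m.
have bd m := hochschild_d_bounded_linear (ell1 R H) m.
have ext m : (forall x : 'I_m.+2 -> H,
      let ex : hochschild_chain (ell1 R H) m.+1 := basis_tens R x in
      hochschild_d (ex - homotopy (hochschild_d ex)) = 0) ->
    forall y : hochschild_chain (ell1 R H) m.+1,
      hochschild_d (homotopy y) + homotopy (hochschild_d y) = y.
  move=> d0 y.
  suff /(congr1 (@^~ y)) : (fun y : hochschild_chain (ell1 R H) m.+1 =>
    hochschild_d (homotopy y) + homotopy (hochschild_d y)) = id by [].
  apply: basis_tens_ext_eq; last by move=> x; exact/homotopy_basisP/d0.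
    have b1 := bounded_linear_comp (bd m.+1) (bh m.+1).
    have b2 := bounded_linear_comp (bh m) (bd m).
    exact: bounded_linearD b1 b2.
  exact: bounded_linear_id.
elim: n z => [|n IH]; apply: ext => x ex.
  exact: (commutative_hochschild_d0 (@ell1_bmulC H)).
rewrite (linearBf (proj1 (bd n.+1))) -[X in X - _]IH hochschild_dd.
by rewrite (linearf0 (proj1 (bh n))) addr0 subrr.
Qed.

End semilattice.

Theorem theorem7p1 (R : realType) :
  exists sigma : forall (n : nat) (H : unitalSemilatticeType),
      hochschild_chain (ell1 R H) n -> hochschild_chain (ell1 R H) n.+1,
    [/\ forall (n : nat) (H : unitalSemilatticeType),
          bounded_linear (sigma n H),
        forall (n : nat) (H K : unitalSemilatticeType)
          (theta : UMagmaMorphism.type H K)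
          (x : hochschild_chain (ell1 R H) n),
          tmap n.+2 (ell1_map theta) (sigma n H x) =
          sigma n K (tmap n.+1 (ell1_map theta) x),
        forall (n : nat) (H : unitalSemilatticeType)
          (x : hochschild_chain (ell1 R H) n.+1),
          hochschild_d (sigma n.+1 H x) + sigma n H (hochschild_d x) = x
      & forall H : unitalSemilatticeType,
          split_exact_ge1 (@hochschild_d R (ell1 R H))].
Proof.
exists (fun n H => @homotopy R H n); split.
- by move=> n H; exact: homotopy_bounded_linear.
- by move=> n H K theta x; exact: homotopy_natural.
- by move=> n H x; exact: homotopyP.
move=> H; split; last first.
  exists (@homotopy R H); split; first exact: homotopy_bounded_linear.
  by move=> n x; exact: homotopyP.
move=> n x; split=> [dx0|[y <-]]; last exact: hochschild_dd.
exists (homotopy x); rewrite -[RHS]homotopyP dx0.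
by rewrite (linearf0 (proj1 (homotopy_bounded_linear _ _ _))) addr0.
Qed.
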